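(* Let $V_{\mathbb R}$ be a real vector space and let $\mathfrak g_{\mathbb R}\subset\mathfrak{sl}(V_{\mathbb R})$ be an irreducible compact linear Lie algebra of rank $r>1$ whose commutator subalgebra is simple. Let $V:=V_{\mathbb R}\otimes_{\mathbb R}\mathbb C$ and $\mathfrak g:=\mathfrak g_{\mathbb R}\otimes_{\mathbb R}\mathbb C\subset\mathfrak{sl}(V)$. (1) If the linear algebra $\mathfrak g_{\mathbb R}\subset\mathfrak{sl}(V_{\mathbb R})$ is an adjoint simple compact linear Lie algebra, then there is no vector $v\in V_{\mathbb R}$ with $\operatorname{rk}\bigl((\mathfrak g_{\mathbb R})_v\bigr)=1$. (2) If the linear algebra $\mathfrak g\subset\mathfrak{sl}(V)$ is reducible and the complex linear algebra $\mathfrak g\subset\mathfrak{gl}_{\mathbb C}(V_{\mathbb R})$ coincides with the linear algebra $\operatorname{ad}([\mathfrak g,\mathfrak g])\oplus\mathbb C E\subset\mathfrak{gl}([\mathfrak g,\mathfrak g])$, then there exists a vector $v\in V_{\mathbb R}$ with $\operatorname{rk}\bigl((\mathfrak g_{\mathbb R})_v\bigr)=1$.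
   Context: All spaces are finite-dimensional. A compact linear Lie algebra in $\mathfrak{gl}(V_{\mathbb R})$ is the Lie algebra of a compact subgroup of $GL(V_{\mathbb R})$. The rank of a compact Lie algebra is the dimension of a maximal commutative subalgebra. $(\mathfrak g_{\mathbb R})_v=\{x\in\mathfrak g_{\mathbb R}: xv=0\}$. If $\mathfrak g\subset\mathfrak{sl}(V)$ is reducible, then $V_{\mathbb R}$ has a $\mathfrak g_{\mathbb R}$-invariant complex structure, and one regards $\mathfrak g=\mathfrak g_{\mathbb R}\oplus i\mathfrak g_{\mathbb R}\subset\mathfrak{gl}_{\mathbb C}(V_{\mathbb R})$ as a complex linear Lie algebra on the complex space $V_{\mathbb R}$. $E$ is the identity operator. Linear Lie algebras are considered up to isomorphism of linear Lie algebras (conjugation by a linear isomorphism of the underlying spaces). A simple linear Lie algebra is adjoint if it is $\operatorname{ad}(\mathfrak s)\subset\mathfrak{gl}(\mathfrak s)$ for a simple Lie algebra $\mathfrak s$. *)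

(* Defs.v *)
From HB Require Import structures.
From mathcomp Require Import all_boot all_order all_algebra.
From mathcomp Require Import complex.
From mathcomp Require Import all_classical all_reals all_analysis.

Set Implicit Arguments.
Unset Strict Implicit.
Unset Printing Implicit Defensive.

Import Order.TTheory GRing.Theory Num.Theory.
Import numFieldNormedType.Exports.

Local Open Scope classical_set_scope.
Local Open Scope ring_scope.

(* Lie algebras, given by a bracket [br] on an ambient finite-dimensional
   space [L].  Subalgebras are subspaces of [L]; an abstract Lie algebra is the
   case of the full subspace, a linear one the case where [br] is the commutator
   of matrices. *)
Section LieAlgebra.
Variables (K : fieldType) (L : vectType K) (br : L -> L -> L).
Implicit Types g h t : {vspace L}.

Definition lie_bracket : Prop :=
  [/\ forall x (a : K) y z, br x (a *: y + z) = a *: br x y + br x z,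
      forall x (a : K) y z, br (a *: y + z) x = a *: br y x + br z x,
      forall x, br x x = 0
    & forall x y z, br x (br y z) + br y (br z x) + br z (br x y) = 0].

Definition lie_subalgebra g : Prop :=
  forall x y, x \in g -> y \in g -> br x y \in g.

Definition lie_commutative g : Prop :=
  forall x y, x \in g -> y \in g -> br x y = 0.

Definition lie_ideal g h : Prop :=
  (h <= g)%VS /\ forall x y, x \in g -> y \in h -> br x y \in h.

Definition lie_simple g : Prop :=
  ~ lie_commutative g /\
  forall h, lie_ideal g h -> h = 0%VS \/ h = g.

(* By bilinearity the brackets of basis vectors span all brackets. *)
Definition lie_commutator g : {vspace L} :=
  (<<[seq br x y | x <- vbasis g, y <- vbasis g]>>)%VS.

Definition maximal_commutative g t : Prop :=
  [/\ (t <= g)%VS, lie_commutative t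
    & forall t' : {vspace L},
        (t' <= g)%VS -> lie_commutative t' -> (t <= t')%VS -> t' = t].

(* A relation rather than a function: for a compact Lie algebra all maximal
   commutative subalgebras are conjugate, so exactly one [r] satisfies it. *)
Definition has_rank g (r : nat) : Prop :=
  exists2 t : {vspace L}, maximal_commutative g t & \dim t = r.

End LieAlgebra.

Definition mxbr (K : fieldType) (n : nat) (x y : 'M[K]_n) : 'M[K]_n :=
  x *m y - y *m x.

Definition in_sl (K : fieldType) (n : nat) (g : {vspace 'M[K]_n}) : Prop :=
  forall x, x \in g -> \tr x = 0.

Definition irreducible_linear (K : fieldType) (n : nat)
    (g : {vspace 'M[K]_n}) : Prop :=
  (0 < n)%N /\
  forall U : {vspace 'cV[K]_n},
    (forall x u, x \in g -> u \in U -> x *m u \in U) ->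
    U = 0%VS \/ U = fullv.

Definition reducible_linear (K : fieldType) (n : nat)
    (g : {vspace 'M[K]_n}) : Prop :=
  exists U : {vspace 'cV[K]_n},
    [/\ forall x u, x \in g -> u \in U -> x *m u \in U,
        U <> 0%VS & U <> fullv].

(* The annihilator [{x \in g | x v = 0}] of [v]. *)
Definition stabilizer (K : fieldType) (n : nat)
    (g : {vspace 'M[K]_n}) (v : 'cV[K]_n) : {vspace 'M[K]_n} :=
  (g :&: lker (linfun (mulmxr v : 'M[K]_n -> 'cV[K]_n)))%VS.

(* Up to conjugation by [phi : S -> K^n], [g] is [ad S] for a simple Lie
   algebra [S]. *)
Definition adjoint_simple (K : fieldType) (n : nat)
    (g : {vspace 'M[K]_n}) : Prop :=
  exists (S : vectType K) (br : S -> S -> S) (phi : 'Hom(S, 'cV[K]_n)),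
    [/\ lie_bracket br,
        lie_simple br fullv,
        lker phi = 0%VS /\ limg phi = fullv
      & forall x : 'M[K]_n,
          x \in g <-> exists y : S, forall u : S, x *m phi u = phi (br y u)].

Section Compact.
Variables (R : realType) (n : nat).

Definition mexp (x : 'M[R]_n) : 'M[R]_n :=
  limn (series (fun k : nat => (k`!%:R : R)^-1 *: x ^+ k)).

Definition compact_linear_group (G : set 'M[R]_n) : Prop :=
  [/\ forall a, G a -> a \in unitmx,
      G 1%:M,
      forall a b, G a -> G b -> G (a *m b),
      forall a, G a -> G (invmx a)
    & compact G].

(* The Lie algebra of a closed subgroup [G] of [GL_n(R)] consists of the [x]
   whose one-parameter group [exp (t x)] stays in [G]. *)
Definition compact_linear_lie_algebra (g : {vspace 'M[R]_n}) : Prop :=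
  exists2 G : set 'M[R]_n, compact_linear_group G &
    forall x : 'M[R]_n, x \in g <-> forall t : R, G (mexp (t *: x)).

End Compact.

Section Complex.
Variables (R : realType) (n : nat).
Implicit Types (g : {vspace 'M[R]_n}) (J : 'M[R]_n).

(* [g (x) C] inside [gl (V (x) C)]: the complex span of [g]. *)
Definition complexify g : {vspace 'M[R[i]]_n} :=
  (<<[seq map_mx (real_complex R) x | x <- vbasis g]>>)%VS.

Definition invariant_complex_structure g J : Prop :=
  J *m J = - 1%:M /\ forall x, x \in g -> J *m x = x *m J.

(* Multiplication by complex scalars defined by [J], on [R^n] (m = 1) and on
   operators of [R^n] (m = n). *)
Definition cscale J (m : nat) (z : R[i]) (u : 'M[R]_(n, m)) : 'M[R]_(n, m) :=
  complex.Re z *: u + complex.Im z *: (J *m u).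

(* [g + i g] acting on [R^n] made complex by [J]; the sum is direct when [g]
   is compact and irreducible.  It is stable under left multiplication by [J],
   and so is its commutator subalgebra: both are complex subspaces. *)
Definition complex_span J g : {vspace 'M[R]_n} :=
  (g + linfun (mulmx J : 'M[R]_n -> 'M[R]_n) @: g)%VS.

(* With [gJ := g + i g] and [s := [gJ, gJ]]: up to conjugation by a
   complex-linear isomorphism [phi] from [s] to [R^n] (made complex by [J]),
   [gJ] is [ad s + C E].  Only the values of [phi] on [s] matter. *)
Definition adjoint_plus_scalars J g : Prop :=
  let gJ := complex_span J g in
  let s := lie_commutator (@mxbr R n) gJ in
  exists phi : 'Hom('M[R]_n, 'cV[R]_n),
    [/\ (lker phi :&: s = 0)%VS,
        (phi @: s = fullv)%VS,
        forall (z : R[i]) u, u \in s ->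
          phi (cscale J z u) = cscale J z (phi u)
      & forall x : 'M[R]_n,
          x \in gJ <->
          exists2 y, y \in s & exists z : R[i],
            forall u, u \in s -> x *m phi u = phi (mxbr y u + cscale J z u)].

End Complex.

(* Main.v *)
Require Import Defs.
From HB Require Import structures.
From mathcomp Require Import all_boot all_order all_algebra.
From mathcomp Require Import complex ring lra.
From mathcomp Require Import all_classical all_reals all_analysis.

Import Order.TTheory GRing.Theory Num.Theory.
Import numFieldNormedType.Exports.

Local Open Scope ring_scope.

Set Implicit Arguments.
Unset Strict Implicit.
Unset Printing Implicit Defensive.

(* Elements of [g] have bounded one-parameter groups, so they are diagonalizable
   over C with imaginary eigenvalues; hence the (automatically invariant) trace
   form is negative definite on [g], and no averaging over the group is needed.

   (1) If a stabilizer had rank one, the line carrying it would be a maximal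
   commutative subalgebra [<h>] of [g].  Minimising [tr (a y a^-1 h)] over the
   group conjugates any [y] into the centralizer [<h>] of [h], so a commutative
   subalgebra of dimension > 1 would be conjugate into a line.

   (2) One shows [J \in g] and [g = k + R J] with [k = [g, g]].  For a maximal
   commutative [t] in [k], the operators [- J h], [h \in t], are simultaneously
   diagonalizable over R; the weights [be j] separate [t] and are symmetric.  A
   vertex [h] of the polyhedron [{be j >= 1 for the positive weights be j}] is
   regular and the weights equal to 1 at [h] span the dual of [t].  (For a root
   system this is [rho^vee], with the simple roots equal to 1.)  If [v] is the
   sum of the corresponding weight vectors, then [h - J] kills [v], and its
   centralizer in the stabilizer of [v] is a line. *)

(** * The matrix exponential *)

Section MatrixExponential.
Variables (R : realType) (n : nat).
Implicit Types (x y : 'M[R]_n) (t : R).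

Local Open Scope classical_set_scope.

Lemma cvg_mx_entries (u : nat -> 'M[R]_n) (l : 'M[R]_n) :
  (forall i j, (fun k => u k i j) @ \oo --> l i j) -> u @ \oo --> l.
Proof.
move=> ul A [P nbP PA].
have : \forall k \near \oo, forall i, forall j, P i j (u k i j).
  by apply: filter_forall => i; apply: filter_forall => j; exact: ul.
by apply: filterS => k Pk; apply: PA.
Qed.

Lemma cvg_sumR (I : finType) (f : I -> R^nat) (l : I -> R) :
  (forall i, f i @ \oo --> l i) -> (fun k => \sum_i f i k) @ \oo --> \sum_i l i.
Proof. by move=> fl; apply: cvg_big => [|i _]; [exact: add_continuous | exact: fl]. Qed.

Lemma limn_mx_entry (u : nat -> 'M[R]_n) i j :
  (forall i j, cvgn (fun k => u k i j)) ->
  (limn u) i j = limn (fun k => u k i j).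
Proof.
move=> cu; have /cvgP cvu : u @ \oo --> (\matrix_(i, j) limn (fun k => u k i j)).
  by apply: cvg_mx_entries => a b; rewrite mxE; exact: cu.
apply/esym/cvg_lim; first exact: Rhausdorff.
exact: (cvg_comp _ _ cvu (@coord_continuous R n n i j _)).
Qed.

Lemma exprZmx t x k : (t *: x) ^+ k = t ^+ k *: x ^+ k.
Proof.
elim: k => [|k IH]; first by rewrite !expr0 scale1r.
by rewrite !exprS IH -[LHS]/(_ *m _) -scalemxAl -scalemxAr scalerA.
Qed.

(** Taylor coefficients in [t] of the [(i, j)] entry of [exp (t x)]. Working entry by entry reduces
    convergence and differentiation to scalar power series. *)
Definition mexp_coeff x i j : R^nat := fun k => (k`!%:R)^-1 * (x ^+ k) i j.

(** The sum of the absolute values of all entries dominates every row sum, so each further factor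
    [x] costs at most one factor [M]. The coefficient series is thereby dominated by an exponential
    series. *)
Lemma expmx_entry_bound x : exists2 M : R, 0 <= M &
  forall k i j, `|(x ^+ k) i j| <= M ^+ k.
Proof.
pose m := \sum_i \sum_j `|x i j|.
have m0 : 0 <= m by apply: sumr_ge0 => i _; apply: sumr_ge0 => ? _.
have rowm i : \sum_j `|x i j| <= m.
  by rewrite /m [leRHS](bigD1 i) //= lerDl; apply: sumr_ge0 => ? _; apply: sumr_ge0 => ? _.
exists m => // k; elim: k => [|k IH] i j.
  by rewrite !expr0 mxE; case: eqP => _; rewrite ?normr1 ?normr0.
rewrite !exprS -[x * _]/(_ *m _) mxE (le_trans (ler_norm_sum _ _ _)) //.
apply: (@le_trans _ _ (\sum_l `|x i l| * m ^+ k)); last first.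
  by rewrite -mulr_suml ler_wpM2r // exprn_ge0.
by apply: ler_sum => l _; rewrite normrM ler_wpM2l.
Qed.

Lemma is_cvg_mexp_coeff x i j t : cvgn (pseries (mexp_coeff x i j) t).
Proof.
have [M M0 xM] := expmx_entry_bound x.
apply: normed_cvg.
apply: (@series_le_cvg _ _ (exp_coeff (M * `|t|))) => [k|k|k|].
- exact: normr_ge0.
- by apply: exp_coeff_ge0; rewrite mulr_ge0.
- rewrite /exp_coeff /= /mexp_coeff !normrM normfV normrX exprMn (ger0_norm (ler0n _ _)).
  rewrite [leRHS]mulrC mulrA ler_wpM2r ?exprn_ge0 //.
  by rewrite ler_wpM2l // invr_ge0.
- exact: is_cvg_series_exp_coeff.
Qed.

Lemma mexpE x t i j : mexp (t *: x) i j = limn (pseries (mexp_coeff x i j) t).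
Proof.
have E a b : (fun k => series (fun k : nat => (k`!%:R : R)^-1 *: (t *: x) ^+ k) k a b)
   = pseries (mexp_coeff x a b) t.
  apply/funext => k; rewrite /series /pseries /= summxE; apply: eq_bigr => l _.
  by rewrite exprZmx !mxE /mexp_coeff mulrA mulrAC.
by rewrite /mexp limn_mx_entry ?E// => a b; rewrite E; exact: is_cvg_mexp_coeff.
Qed.

Lemma pseries_diffs_mexp_coeff x i j k :
  pseries_diffs (mexp_coeff x i j) k = \sum_l x i l * mexp_coeff x l j k.
Proof.
rewrite /pseries_diffs /mexp_coeff factS natrM invfM mulrA mulrA mulfV //.
rewrite mul1r exprS -[x * _]/(_ *m _) mxE mulr_sumr.
by apply: eq_bigr => l _; rewrite mulrCA.
Qed.

Lemma pseries_diffs_mexp_cvg x i j t :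
  pseries (pseries_diffs (mexp_coeff x i j)) t @ \oo -->
  (x *m mexp (t *: x)) i j.
Proof.
rewrite mxE; under eq_bigr do rewrite mexpE.
have -> : pseries (pseries_diffs (mexp_coeff x i j)) t =
   (fun k => \sum_l x i l * pseries (mexp_coeff x l j) t k).
  apply/funext => k; rewrite /pseries /series /=.
  under eq_bigr do rewrite pseries_diffs_mexp_coeff mulr_suml.
  rewrite exchange_big; apply: eq_bigr => l _; rewrite mulr_sumr.
  by apply: eq_bigr => p _; rewrite mulrA.
apply: cvg_sumR => l; apply: cvgM; first exact: cvg_cst.
exact: is_cvg_mexp_coeff.
Qed.

Lemma is_derive_mexp x t i j :
  is_derive t (1 : R) (fun t => mexp (t *: x) i j) ((x *m mexp (t *: x)) i j).
Proof.
have -> : (fun t => mexp (t *: x) i j) =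
          (fun t => limn (pseries (mexp_coeff x i j) t)).
  by apply/funext => s; rewrite mexpE.
rewrite -(cvg_lim (@Rhausdorff R) (@pseries_diffs_mexp_cvg x i j t)).
have c1 a b s : cvgn (pseries (pseries_diffs (mexp_coeff x a b)) s).
  exact: cvgP (@pseries_diffs_mexp_cvg x a b s).
(* Every series involved converges on the whole line, so any radius exceeding the absolute value of
   [t] serves. *)
apply: (@pseries_snd_diffs _ _ (`|t| + 1)) => //.
- exact: is_cvg_mexp_coeff.
- have -> : pseries_diffs (pseries_diffs (mexp_coeff x i j)) =
      (fun k => \sum_l x i l * pseries_diffs (mexp_coeff x l j) k).
    apply/funext => k.
    transitivity (k.+1%:R * pseries_diffs (mexp_coeff x i j) k.+1) => //.
    rewrite pseries_diffs_mexp_coeff mulr_sumr; apply: eq_bigr => l _.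
    by rewrite mulrCA.
  set s := `|t| + 1.
  have -> : pseries ((fun k => \sum_l x i l * pseries_diffs (mexp_coeff x l j) k)) s
     = (fun k => \sum_l x i l * pseries (pseries_diffs (mexp_coeff x l j)) s k).
    apply/funext => k; rewrite /pseries /series /=.
    under eq_bigr do rewrite mulr_suml.
    rewrite exchange_big; apply: eq_bigr => l _; rewrite mulr_sumr.
    by apply: eq_bigr => p _; rewrite mulrA.
  apply/cvg_ex; exists (\sum_l x i l * limn (pseries (pseries_diffs (mexp_coeff x l j)) s)).
  by apply: cvg_sumR => l; apply: cvgM; [exact: cvg_cst | exact: c1].
- by rewrite [ltRHS]ger0_norm ?addr_ge0 // ltrDl.
Qed.

Lemma mexp0 : mexp (0 : 'M[R]_n) = 1%:M.
Proof.
apply/matrixP => i j; rewrite -(scale0r (0 : 'M[R]_n)) mexpE.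
apply/cvg_lim; first exact: Rhausdorff.
(* The empty partial sum is 0; from index 1 on, the partial sums at [t = 0] are constant. *)
rewrite -(cvg_shiftn 1) /=.
have -> : (fun k => pseries (mexp_coeff 0 i j) 0 (k + 1)%N) = fun=> (1%:M : 'M[R]_n) i j.
  apply/funext => k; rewrite /pseries /series /= addn1 big_nat_recl //.
  rewrite big1 => [|l _]; last by rewrite expr0n mulr0.
  by rewrite /mexp_coeff !expr0 fact0 invr1 mul1r mulr1 addr0.
exact: cvg_cst.
Qed.

(** The relation passes to powers, so both sides are limits of the same sequence [s]. With
    [p = x = y] this says that [x] commutes with its exponential; with [p] invertible it gives the
    conjugation formula. *)
Lemma mexp_intertwine x y (p : 'M[R]_n) t :
  x *m p = p *m y -> mexp (t *: x) *m p = p *m mexp (t *: y).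
Proof.
move=> xp; have xpk k : x ^+ k *m p = p *m y ^+ k.
  elim: k => [|k IH]; first by rewrite !expr0 mul1mx mulmx1.
  rewrite exprS -[x * _]/(_ *m _) -mulmxA IH mulmxA xp -mulmxA.
  by rewrite exprS -[y * _]/(_ *m _).
apply/matrixP => i j; rewrite !mxE.
pose s m := \sum_(0 <= k < m) (k`!%:R)^-1 * t ^+ k * (x ^+ k *m p) i j.
apply: (@cvg_unique _ (@Rhausdorff R) (s @ \oo)).
  have -> : s = (fun k => \sum_l pseries (mexp_coeff x i l) t k * p l j).
    apply/funext => k; rewrite /s /pseries /series /=.
    under [RHS]eq_bigr do rewrite mulr_suml.
    rewrite [RHS]exchange_big; apply: eq_bigr => q _ /=; rewrite mxE mulr_sumr.
    by apply: eq_bigr => l _; rewrite /mexp_coeff; ring.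
  apply: cvg_sumR => l; rewrite mexpE; apply: cvgM; last exact: cvg_cst.
  exact: is_cvg_mexp_coeff.
have -> : s = (fun k => \sum_l p i l * pseries (mexp_coeff y l j) t k).
  apply/funext => k; rewrite /s /pseries /series /=.
  under [RHS]eq_bigr do rewrite mulr_sumr.
  rewrite [RHS]exchange_big; apply: eq_bigr => q _ /=; rewrite xpk mxE mulr_sumr.
  by apply: eq_bigr => l _; rewrite /mexp_coeff; ring.
apply: cvg_sumR => l; rewrite mexpE; apply: cvgM; first exact: cvg_cst.
exact: is_cvg_mexp_coeff.
Qed.

Lemma is_derive_sumR (I : finType) (f : I -> R -> R) (df : I -> R) t :
  (forall i, is_derive t (1 : R) (f i) (df i)) ->
  is_derive t (1 : R) (fun s => \sum_i f i s) (\sum_i df i).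
Proof.
move=> fd; rewrite (_ : (fun s => _) = \sum_(k < #|I|) f (enum_val k)).
  apply: is_derive_eq; rewrite (reindex (@enum_val I predT)) //=.
  exact/onW_bij/enum_val_bij.
apply/funext => s; rewrite fct_sumE (reindex (@enum_val I predT)) //=.
exact/onW_bij/enum_val_bij.
Qed.

Lemma is_derive_mexp_mul x t (p : nat) (u : 'M[R]_(n, p)) i j :
  is_derive t (1 : R) (fun t => (mexp (t *: x) *m u) i j)
    ((mexp (t *: x) *m (x *m u)) i j).
Proof.
have -> : (fun t => (mexp (t *: x) *m u) i j) =
          (fun t => \sum_l mexp (t *: x) i l * u l j).
  by apply/funext => s; rewrite mxE.
rewrite mulmxA (@mexp_intertwine x x x) // mxE.
apply: is_derive_sumR => l.
have := is_derive_mexp x t i l => ?.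
have -> : (fun s => mexp (s *: x) i l * u l j) =
          (fun s => mexp (s *: x) i l) * cst (u l j) by [].
by apply: is_derive_eq; rewrite scaler0 add0r [LHS]mulrC.
Qed.

(** The product has zero derivative in [t], hence keeps its value at [t = 0]. *)
Lemma mexpN x t : mexp (t *: x) *m mexp (t *: - x) = 1%:M.
Proof.
apply/matrixP => i j.
transitivity ((mexp (0 *: x) *m mexp (0 *: - x)) i j); last first.
  by rewrite !scale0r mexp0 mul1mx.
apply: (@is_derive_0_is_cst _ (fun t => (mexp (t *: x) *m mexp (t *: - x)) i j)) => s.
have -> : (fun t => (mexp (t *: x) *m mexp (t *: - x)) i j) =
          (fun t => \sum_l mexp (t *: x) i l * mexp (t *: - x) l j).
  by apply/funext => r; rewrite mxE.
pose d l := mexp (s *: x) i l * (- x *m mexp (s *: - x)) l j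
  + (x *m mexp (s *: x)) i l * mexp (s *: - x) l j.
have H l : is_derive s (1 : R)
    (fun t => mexp (t *: x) i l * mexp (t *: - x) l j) (d l).
  have := is_derive_mexp x s i l => ?; have := is_derive_mexp (- x) s l j => ?.
  have -> : (fun s => mexp (s *: x) i l * mexp (s *: - x) l j) =
    (fun s => mexp (s *: x) i l) * (fun s => mexp (s *: - x) l j) by [].
  by apply: is_derive_eq; congr (_ + _); rewrite [LHS]mulrC.
apply: (is_derive_eq (is_derive_sumR H)).
rewrite big_split /=.
have -> : \sum_l mexp (s *: x) i l * (- x *m mexp (s *: - x)) l j =
   (mexp (s *: x) *m (- x *m mexp (s *: - x))) i j by rewrite mxE.
have -> : \sum_l (x *m mexp (s *: x)) i l * mexp (s *: - x) l j =
   ((x *m mexp (s *: x)) *m mexp (s *: - x)) i j by rewrite mxE.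
by rewrite -(@mexp_intertwine x x x) // mulNmx mulmxN mulmxA mxE addNr.
Qed.
End MatrixExponential.

(** * Bounded one-parameter groups *)

Section BoundedSolutions.
Variable R : realType.
Implicit Types (f : R -> R) (c m M : R).

Lemma bounded_exponential_growth f c M :
  (forall t, is_derive t (1 : R) f (c * f t)) -> (forall t, `|f t| <= M) ->
  c = 0 \/ f 0 = 0.
Proof.
move=> fd fM; have [->|c0] := eqVneq c 0; [by left | right].
apply/eqP; apply: contraT => f0.
have E t : f t * expR (- c * t) = f 0.
  transitivity (f 0 * expR (- c * 0)); last by rewrite mulr0 expR0 mulr1.
  apply: (@is_derive_0_is_cst _ (fun t => f t * expR (- c * t))) => s.
  have := fd s => ?.
  have -> : (fun t => f t * expR (- c * t)) = f * (expR \o (- c \*: id)) by [].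
  apply: is_derive_eq.
  rewrite /= /GRing.scale /=; ring.
have f0p : 0 < `|f 0| by rewrite normr_gt0.
(* With [A] the absolute value of [f 0], at this time [f] has absolute value [A exp (M / A)], which
   is at least [A + M] because [exp r >= 1 + r]. *)
have := fM (M / `|f 0| / c); rewrite leNgt => /negP; case.
have -> : f (M / `|f 0| / c) = f 0 * expR (M / `|f 0|).
  move: (_ / `|f 0|) => r; rewrite -(E (r / c)) -mulrA -expRD mulNr mulrCA mulfV // mulr1.
  by rewrite addNr expR0 mulr1.
rewrite normrM (ger0_norm (expR_ge0 _)).
apply: (@lt_le_trans _ _ (`|f 0| * (1 + M / `|f 0|))).
  by rewrite mulrDr mulr1 mulrCA mulfV ?gt_eqF // mulr1 ltrDr.
by rewrite ler_pM2l // expR_ge1Dx.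
Qed.

Lemma bounded_affine f m M :
  (forall t, is_derive t (1 : R) f m) -> (forall t, `|f t| <= M) -> m = 0.
Proof.
move=> fd fM; apply/eqP; apply: contraT => m0.
have E t : f t - m * t = f 0.
  transitivity (f 0 - m * 0); last by rewrite mulr0 subr0.
  apply: (@is_derive_0_is_cst _ (fun t => f t - m * t)) => s.
  have := fd s => ?.
  have -> : (fun t => f t - m * t) = f - (m \*: id) by [].
  by apply: is_derive_eq; rewrite /GRing.scale /= mulr1 subrr.
have M0 : 0 <= M by apply: le_trans (fM 0).
have := fM ((1 + M + `|f 0|) / m); rewrite leNgt => /negP; case.
have -> : f ((1 + M + `|f 0|) / m) = f 0 + (1 + M + `|f 0|).
  by move: (_ + `|f 0|) => r; rewrite -(E (r / m)) mulrCA mulfV // mulr1 subrK.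
have := ler_norm (f 0 + (1 + M + `|f 0|)); have := ler_norm (- f 0).
rewrite normrN; lra.
Qed.

Let sqr_sum_eq0 (u v : R) : u ^+ 2 + v ^+ 2 = 0 -> u = 0 /\ v = 0.
Proof.
by move/eqP; rewrite paddr_eq0 ?sqr_ge0 // !sqrf_eq0 => /andP[/eqP ? /eqP ?].
Qed.

(** [A + i B] solves [w' = (c + i be) w], so its squared modulus solves [f' = 2 c f]. *)
Lemma bounded_spiral (A B : R -> R) c be MA MB :
  (forall t, is_derive t (1 : R) A (c * A t - be * B t)) ->
  (forall t, is_derive t (1 : R) B (be * A t + c * B t)) ->
  (forall t, `|A t| <= MA) -> (forall t, `|B t| <= MB) ->
  c = 0 \/ A 0 = 0 /\ B 0 = 0.
Proof.
move=> dA dB bA bB; have [->|c0] := eqVneq c 0; [by left | right].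
apply: sqr_sum_eq0.
have [||E|//] := @bounded_exponential_growth (fun t => A t ^+ 2 + B t ^+ 2)
  (2 * c) (MA ^+ 2 + MB ^+ 2).
- move=> t; have := dA t => ?; have := dB t => ?.
  have -> : (fun t => A t ^+ 2 + B t ^+ 2) = A * A + B * B by [].
  by apply: is_derive_eq; rewrite /GRing.scale /=; ring.
- move=> t; rewrite ger0_norm ?addr_ge0 ?sqr_ge0 //.
  have sq (u v : R) : `|u| <= v -> u ^+ 2 <= v ^+ 2.
    move=> uv; rewrite -real_normK ?num_real // lerXn2r ?nnegrE //.
    exact: le_trans uv.
  by apply: lerD; apply: sq; [exact: bA | exact: bB].
- by move/eqP: E; rewrite mulf_eq0 pnatr_eq0 (negPf c0).
Qed.

(* [A1 ^ 2 + B1 ^ 2] is conserved and is the slope of the bounded function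
   [A A1 + B B1]. *)
Lemma bounded_resonance (A B A1 B1 : R -> R) be MA MB MA1 MB1 :
  (forall t, is_derive t (1 : R) A (- be * B t + A1 t)) ->
  (forall t, is_derive t (1 : R) B (be * A t + B1 t)) ->
  (forall t, is_derive t (1 : R) A1 (- be * B1 t)) ->
  (forall t, is_derive t (1 : R) B1 (be * A1 t)) ->
  (forall t, `|A t| <= MA) -> (forall t, `|B t| <= MB) ->
  (forall t, `|A1 t| <= MA1) -> (forall t, `|B1 t| <= MB1) ->
  A1 0 = 0 /\ B1 0 = 0.
Proof.
move=> dA dB dA1 dB1 bA bB bA1 bB1; apply: sqr_sum_eq0.
have cst1 t : A1 t ^+ 2 + B1 t ^+ 2 = A1 0 ^+ 2 + B1 0 ^+ 2.
  apply: (@is_derive_0_is_cst _ (fun t => A1 t ^+ 2 + B1 t ^+ 2)) => s.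
  have := dA1 s => ?; have := dB1 s => ?.
  have -> : (fun t => A1 t ^+ 2 + B1 t ^+ 2) = A1 * A1 + B1 * B1 by [].
  by apply: is_derive_eq; rewrite /GRing.scale /=; ring.
apply: (@bounded_affine (fun t => A t * A1 t + B t * B1 t) _ (MA * MA1 + MB * MB1)) => t.
  have := dA t => ?; have := dB t => ?; have := dA1 t => ?; have := dB1 t => ?.
  have -> : (fun t => A t * A1 t + B t * B1 t) = A * A1 + B * B1 by [].
  by apply: is_derive_eq; rewrite -(cst1 t) /GRing.scale /=; ring.
apply: le_trans (ler_normD _ _) _; rewrite !normrM.
by apply: lerD; apply: ler_pM.
Qed.
End BoundedSolutions.

(** The hypothesis excludes Jordan blocks of size two. Repeated factors can then be dropped from the
    minimal polynomial without losing the annihilation of [A], so its roots are simple. *)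
Lemma diagonalizable_ker2 (F : closedFieldType) (n : nat) (A : 'M[F]_n) :
  (forall (w : 'M[F]_n) z,
     (A - z%:M) *m ((A - z%:M) *m w) = 0 -> (A - z%:M) *m w = 0) ->
  diagonalizable A.
Proof.
case: n A => [|m] A ker2.
  exists 1%:M; first exact: unitmx1.
  by apply/is_diag_mxP => -[].
apply/diagonalizableP.
have [r rE] := closed_field_poly_normal (mxminpoly A).
exists (undup r); first exact: undup_uniq.
have hX z : horner_mx A ('X - z%:P) = A - z%:M.
  by rewrite rmorphB /= horner_mx_X horner_mx_C.
have root_ker (s : seq F) (w : 'M[F]_m.+1) :
    horner_mx A (\prod_(z <- s) ('X - z%:P)) *m w = 0 ->
    horner_mx A (\prod_(z <- undup s) ('X - z%:P)) *m w = 0.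
  elim: s w => [|z s IH] w //=; rewrite big_cons rmorphM /= hX => Aw.
  have {}Aw : horner_mx A (\prod_(z <- undup s) ('X - z%:P)) *m ((A - z%:M) *m w) = 0.
    apply: IH; rewrite mulmxA -[_ *m w]/(_ * w) -hX -[X in X * w]rmorphM.
    by rewrite mulrC rmorphM /= hX.
  (* If [z] occurs again later, its factor is pulled to the front, where [ker2] absorbs the second
     copy; otherwise the factor is kept. *)
  case: ifPn => zs.
    have pe : perm_eq (undup s) (z :: rem z (undup s)).
      by apply: perm_to_rem; rewrite mem_undup.
    move: Aw; rewrite !(perm_big _ pe) /= big_cons rmorphM /= hX.
    set q := horner_mx A _ => Aw.
    have qA : q *m (A - z%:M) = (A - z%:M) *m q.
      by rewrite -hX -[LHS]/(_ * _) -[RHS]/(_ * _) -!rmorphM mulrC.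
    rewrite -[_ * q]/(_ *m q) -mulmxA; apply: ker2.
    by rewrite -Aw -[_ * q]/(_ *m q) -!mulmxA (mulmxA q) qA -!mulmxA.
  rewrite big_cons mulrC rmorphM /= hX -[_ * (A - _)]/(_ *m (A - _)).
  by rewrite -mulmxA.
apply: mxminpoly_min; rewrite -[LHS]mulmx1; apply: root_ker; rewrite mulmx1.
move: rE; rewrite (monicP (mxminpoly_monic A)) scale1r => <-.
exact: mx_root_minpoly.
Qed.

Definition bounded_mexp (R : realType) (n : nat) (x : 'M[R]_n) : Prop :=
  exists M : R, forall t i j, `|mexp (t *: x) i j| <= M.

Section BoundedMexp.
Variables (R : realType) (n : nat) (x : 'M[R]_n).
Hypothesis bx : bounded_mexp x.

Lemma bounded_mexp_mul p (u : 'M[R]_(n, p)) :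
  exists M : R, forall t i j, `|(mexp (t *: x) *m u) i j| <= M.
Proof.
have [M xM] := bx.
exists (\sum_j \sum_l M * `|u l j|) => t i j; rewrite mxE.
have M0 : 0 <= M by apply: le_trans (xM 0 i i).
apply: le_trans (ler_norm_sum _ _ _) _.
rewrite [leRHS](bigD1 j) //=.
apply: (@le_trans _ _ (\sum_l M * `|u l j|)); last first.
  rewrite lerDl; apply: sumr_ge0 => ? _; apply: sumr_ge0 => ? _.
  by rewrite mulr_ge0.
by apply: ler_sum => l _; rewrite normrM ler_wpM2r.
Qed.

(** This is the real form of [x w = (al + i be) w] for [w = a + i b]: the entries of [exp (t x) a]
    and [exp (t x) b] form a spiral, bounded only if it is a circle or zero. *)
Lemma bounded_mexp_real_part p (a b : 'M[R]_(n, p)) (al be : R) :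
  x *m a = al *: a - be *: b -> x *m b = be *: a + al *: b ->
  al = 0 \/ a = 0 /\ b = 0.
Proof.
move=> xa xb; have [->|/eqP al0] := eqVneq al 0; [by left | right].
have [Ma aM] := bounded_mexp_mul a; have [Mb bM] := bounded_mexp_mul b.
suff H i j : a i j = 0 /\ b i j = 0.
  by split; apply/matrixP => i j; rewrite mxE; have [] := H i j.
pose f (u : 'M[R]_(n, p)) t := (mexp (t *: x) *m u) i j.
have f0 u : f u 0 = u i j by rewrite /f scale0r mexp0 mul1mx.
have [t|t|t|t|//|[]] := @bounded_spiral R (f a) (f b) al be Ma Mb.
- apply: (is_derive_eq (is_derive_mexp_mul x t a i j)).
  by rewrite xa -scaleNr mulmxDr -!scalemxAr -mulNr [LHS]mxE; congr (_ + _); rewrite [LHS]mxE.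
- apply: (is_derive_eq (is_derive_mexp_mul x t b i j)).
  by rewrite xb mulmxDr -!scalemxAr [LHS]mxE; congr (_ + _); rewrite [LHS]mxE.
- exact: aM.
- exact: bM.
- by rewrite !f0.
Qed.

(** In complex terms [x w = i be w + w1] and [x w1 = i be w1]: a Jordan chain of length two would
    make [exp (t x) w] grow linearly. *)
Lemma bounded_mexp_no_jordan p (a b a1 b1 : 'M[R]_(n, p)) (be : R) :
  x *m a = - be *: b + a1 -> x *m b = be *: a + b1 ->
  x *m a1 = - be *: b1 -> x *m b1 = be *: a1 -> a1 = 0 /\ b1 = 0.
Proof.
move=> xa xb xa1 xb1.
have [Ma aM] := bounded_mexp_mul a; have [Mb bM] := bounded_mexp_mul b.
have [Ma1 a1M] := bounded_mexp_mul a1; have [Mb1 b1M] := bounded_mexp_mul b1.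
suff H i j : a1 i j = 0 /\ b1 i j = 0.
  by split; apply/matrixP => i j; rewrite mxE; have [] := H i j.
pose f (u : 'M[R]_(n, p)) t := (mexp (t *: x) *m u) i j.
have f0 u : f u 0 = u i j by rewrite /f scale0r mexp0 mul1mx.
have [t|t|t|t|t|t|t|t|] := @bounded_resonance R (f a) (f b) (f a1) (f b1) be Ma Mb Ma1 Mb1.
- apply: (is_derive_eq (is_derive_mexp_mul x t a i j)).
  by rewrite xa mulmxDr -!scalemxAr [LHS]mxE; congr (_ + _); rewrite [LHS]mxE.
- apply: (is_derive_eq (is_derive_mexp_mul x t b i j)).
  by rewrite xb mulmxDr -!scalemxAr [LHS]mxE; congr (_ + _); rewrite [LHS]mxE.
- apply: (is_derive_eq (is_derive_mexp_mul x t a1 i j)).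
  by rewrite xa1 -!scalemxAr [LHS]mxE.
- apply: (is_derive_eq (is_derive_mexp_mul x t b1 i j)).
  by rewrite xb1 -!scalemxAr [LHS]mxE.
- exact: aM.
- exact: bM.
- exact: a1M.
- exact: b1M.
- by rewrite !f0.
Qed.

Let X := map_mx (real_complex R) x.
Let re p (w : 'M[R[i]]_(n, p)) : 'M[R]_(n, p) := map_mx (@complex.Re R) w.
Let im p (w : 'M[R[i]]_(n, p)) : 'M[R]_(n, p) := map_mx (@complex.Im R) w.

Let reM p (w : 'M[R[i]]_(n, p)) : re (X *m w) = x *m re w.
Proof.
apply/matrixP => i j; rewrite !mxE (raddf_sum (@complex.Re R)).
by apply: eq_bigr => l _; rewrite !mxE; case: (w l j) => u v /=; rewrite mul0r subr0.
Qed.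

Let imM p (w : 'M[R[i]]_(n, p)) : im (X *m w) = x *m im w.
Proof.
apply/matrixP => i j; rewrite !mxE (raddf_sum (@complex.Im R)).
by apply: eq_bigr => l _; rewrite !mxE; case: (w l j) => u v /=; rewrite mul0r addr0.
Qed.

Let reZ p z (w : 'M[R[i]]_(n, p)) :
  re (z *: w) = complex.Re z *: re w - complex.Im z *: im w.
Proof. by apply/matrixP => i j; rewrite !mxE; case: z (w i j) => [? ?] [? ?]. Qed.

Let imZ p z (w : 'M[R[i]]_(n, p)) :
  im (z *: w) = complex.Im z *: re w + complex.Re z *: im w.
Proof.
by apply/matrixP => i j; rewrite !mxE; case: z (w i j) => [? ?] [? ?] /=; rewrite addrC.
Qed.

Let re_im0 p (w : 'M[R[i]]_(n, p)) : re w = 0 -> im w = 0 -> w = 0.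
Proof.
move=> /matrixP r /matrixP s; apply/matrixP => i j.
by have := r i j; have := s i j; rewrite !mxE; case: (w i j) => /= ? ? -> ->.
Qed.

Lemma bounded_mexp_eigenvalue p (w : 'M[R[i]]_(n, p)) z :
  X *m w = z *: w -> w != 0 -> complex.Re z = 0.
Proof.
move=> Xw w0; have := reM w; have := imM w; rewrite Xw reZ imZ => hi hr.
have [//|[r0 i0]] := @bounded_mexp_real_part _ (re w) (im w) _ _ (esym hr) (esym hi).
by rewrite (re_im0 r0 i0) eqxx in w0.
Qed.

Lemma bounded_mexp_ker2 p (w : 'M[R[i]]_(n, p)) z :
  (X - z%:M) *m ((X - z%:M) *m w) = 0 -> (X - z%:M) *m w = 0.
Proof.
set w1 := (X - z%:M) *m w => Xw1; apply/eqP; apply: contraT => w10.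
have Ew1 : X *m w1 = z *: w1.
  by apply/eqP; rewrite -subr_eq0 -mul_scalar_mx -mulmxBl Xw1.
have z0 := bounded_mexp_eigenvalue Ew1 w10.
have Ew : X *m w = z *: w + w1 by rewrite /w1 mulmxBl mul_scalar_mx addrC subrK.
have reD u v : re (u + v) = re u + re v :> 'M[R]_(n, p) by exact: map_mxD.
have imD u v : im (u + v) = im u + im v :> 'M[R]_(n, p) by exact: map_mxD.
have hr := reM w; have hi := imM w; have hr1 := reM w1; have hi1 := imM w1.
move: hr hi hr1 hi1; rewrite Ew Ew1 reD imD !reZ !imZ z0 !scale0r.
rewrite !sub0r !addr0 -!scaleNr => hr hi hr1 hi1.
have [r0 i0] := bounded_mexp_no_jordan (esym hr) (esym hi) (esym hr1) (esym hi1).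
by rewrite (re_im0 r0 i0) eqxx in w10.
Qed.

Lemma bounded_mexp_spectrum (P : 'M[R[i]]_n) (d : 'rV[R[i]]_n) :
  P \in unitmx -> P *m X = diag_mx d *m P -> forall j, complex.Re (d 0 j) = 0.
Proof.
move=> Pu PX j.
apply: (@bounded_mexp_eigenvalue _ (col j (invmx P))).
  have XP : X *m invmx P = invmx P *m diag_mx d.
    apply: (can_inj (mulKmx Pu)).
    by rewrite mulmxA PX mulmxK // mulmxA mulmxV // mul1mx.
  rewrite colE mulmxA XP -mulmxA -[diag_mx d *m _]colE scalemxAr; congr (_ *m _).
  apply/colP => i; rewrite !mxE eqxx andbT.
  by case: eqP => [->|_]; rewrite ?mulr1 ?mulr0 ?mulr1n ?mulr0n.
apply/eqP => /(congr1 (mulmx P)); rewrite colE mulmxA mulmxV // mul1mx mulmx0.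
by move/matrixP/(_ j 0); rewrite !mxE !eqxx; apply/eqP/oner_neq0.
Qed.

Lemma bounded_mexp_diagonalizable : diagonalizable X.
Proof. by apply: diagonalizable_ker2 => w z; exact: bounded_mexp_ker2. Qed.

(** With eigenvalues [i d_j], the trace of [x ^ 2] is minus the sum of the [d_j ^ 2]. If it
    vanishes, so do all eigenvalues, and a diagonalizable matrix with zero spectrum is zero. *)
Lemma bounded_mexp_trace_sqr : \tr (x *m x) <= 0 ?= iff (x == 0).
Proof.
have [P Pu /diagonalizable_forPex[d /(simmxP Pu) PX]] := bounded_mexp_diagonalizable.
have d0 := bounded_mexp_spectrum Pu PX.
have XE : X = invmx P *m diag_mx d *m P by rewrite -mulmxA -PX mulKmx.
have trE : \tr (x *m x) = - \sum_j complex.Im (d 0 j) ^+ 2.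
  have : \tr (X *m X) = \sum_j d 0 j * d 0 j.
    rewrite XE mxtrace_mulC -!mulmxA (mulmxA P) mulmxV // mul1mx.
    rewrite mulmxA mxtrace_mulC mulmxA mulmxK // mulmx_diag mxtrace_diag.
    by apply: eq_bigr => j _; rewrite mxE.
  rewrite -map_mxM trace_map_mx => /(congr1 (@complex.Re R)).
  rewrite (raddf_sum (@complex.Re R)) /= => ->; rewrite -sumrN.
  apply: eq_bigr => j _; have := d0 j; case: (d 0 j) => a b /= ->.
  by rewrite mul0r sub0r.
split; first by rewrite trE oppr_le0; apply: sumr_ge0 => j _; exact: sqr_ge0.
apply/eqP/eqP => [|->]; last by rewrite mulmx0 mxtrace0.
rewrite trE => /eqP; rewrite oppr_eq0 psumr_eq0 => [/allP d0'|j _]; last exact: sqr_ge0.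
have d00 : d = 0.
  apply/rowP => j; rewrite mxE; have := d0 j; have := d0' j (mem_index_enum j).
  by rewrite /= sqrf_eq0; case: (d 0 j) => a b /= /eqP -> ->.
apply: (@map_mx_inj _ _ (real_complex R)); rewrite -/X XE d00.
by rewrite raddf0 mulmx0 mul0mx map_mx0.
Qed.
End BoundedMexp.

(** * Boundedness of compact matrix groups *)

Section CompactGroup.
Variables (R : realType) (n : nat).
Local Open Scope classical_set_scope.

Lemma compact_mx_bounded (G : set 'M[R]_n) : compact G ->
  exists M : R, forall a, G a -> forall i j, `|a i j| <= M.
Proof.
move=> cG.
have bij i j : exists M : R, forall a, G a -> `|a i j| <= M.
  have /compact_bounded[M [_ HM]] : compact ((fun a : 'M[R]_n => a i j) @` G).
    apply: continuous_compact => //.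
    exact/continuous_subspaceT/(@coord_continuous R n n i j).
  by exists (M + 1) => a Ga; apply: (HM (M + 1)); [rewrite ltrDl | exists a].
pose f i j := projT1 (cid (bij i j)).
exists (\sum_i \sum_j `|f i j|) => a Ga i j.
have := projT2 (cid (bij i j)) a Ga; rewrite -/(f i j) => aij.
apply: (le_trans aij); apply: (le_trans (ler_norm _)).
rewrite (bigD1 i) //= (bigD1 j) //= -addrA lerDl addr_ge0 //.
  by apply: sumr_ge0 => ? _.
by apply: sumr_ge0 => ? _; apply: sumr_ge0 => ? _.
Qed.

End CompactGroup.

(** * Real diagonalization and a Schur lemma *)

Lemma simultaneous_diagonalization (F : fieldType) n (As : seq 'M[F]_n) :
  {in As &, forall A B, A *m B = B *m A} ->
  {in As, forall A, diagonalizable A} ->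
  exists2 P : 'M[F]_n, P \in unitmx &
    forall A, A \in As -> exists d : 'rV[F]_n, P *m A = diag_mx d *m P.
Proof.
move=> cAs dAs.
have [cod _] := codiagonalizableP As; have [P Pu /allP PA] := cod (conj cAs dAs).
exists P => // A /PA /diagonalizable_forPex[d /(simmxP Pu) PAd].
by exists d.
Qed.

Section RealDiagonalization.
Variable (R : realType).

(** Minimal polynomials are invariant under similarity and under extension of scalars, so [S] shares
    its minimal polynomial with a real diagonal matrix. *)
Lemma real_spectrum_diagonalizable n (S : 'M[R]_n) (P : 'M[R[i]]_n) (d : 'rV[R[i]]_n) :
  P \in unitmx -> P *m map_mx (real_complex R) S = diag_mx d *m P ->
  (forall j, complex.Im (d 0 j) = 0) -> diagonalizable S.
Proof.
case: n S P d => [|n] S P d Pu PS d0.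
  exists 1%:M; first exact: unitmx1.
  by apply/is_diag_mxP => -[].
pose e : 'rV[R]_n.+1 := map_mx (@complex.Re R) d.
have dE : d = map_mx (real_complex R) e.
  by apply/rowP => j; rewrite !mxE; have := d0 j; case: (d 0 j) => a b /= ->.
have /diagonalizableP[rs urs rsP] : diagonalizable (diag_mx e).
  exact: diagonalizable_diag.
suff SE : mxminpoly S = mxminpoly (diag_mx e).
  by apply/diagonalizableP; exists rs; [exact: urs | rewrite SE].
apply: (map_poly_inj (real_complex R)).
rewrite -[LHS]mxminpoly_map -[RHS]mxminpoly_map.
rewrite [map_mx _ (diag_mx e)]map_diag_mx -dE.
by apply: (simmx_minpoly Pu); apply/simmxP.
Qed.

(** The commuting matrices [x] and [J] are simultaneously diagonalizable over C with imaginary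
    eigenvalues, and a product of two imaginary numbers is real. *)
Lemma bounded_mexp_complex_structure n (x J : 'M[R]_n) :
  bounded_mexp x -> bounded_mexp J -> J *m x = x *m J -> diagonalizable (J *m x).
Proof.
move=> bx bJ Jx.
pose f := map_mx (real_complex R).
have [||P Pu Pd] := @simultaneous_diagonalization _ _ [:: f n n x; f n n J].
- have fJx : f n n J *m f n n x = f n n x *m f n n J by rewrite /f -!map_mxM Jx.
  move=> A B; rewrite !inE => /orP[] /eqP -> /orP[] /eqP ->.
  - by [].
  - by rewrite fJx.
  - by rewrite fJx.
  - by [].
- by move=> A; rewrite !inE => /orP[] /eqP ->; exact: bounded_mexp_diagonalizable.
have [|dx Px] := Pd (f n n x); first by rewrite !inE eqxx.
have [|dJ PJ] := Pd (f n n J); first by rewrite !inE eqxx orbT.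
apply: (@real_spectrum_diagonalizable _ _ P (\row_j (dJ 0 j * dx 0 j)) Pu).
  by rewrite map_mxM (mulmxA P) PJ -mulmxA Px (mulmxA (diag_mx dJ)) mulmx_diag.
move=> j; rewrite mxE.
have := bounded_mexp_spectrum bx Pu Px j; have := bounded_mexp_spectrum bJ Pu PJ j.
by case: (dJ 0 j) (dx 0 j) => [a b] [c e] /= -> ->; rewrite mul0r mulr0 addr0.
Qed.

(** Since [c] has imaginary spectrum, [c ^ 2] has a real eigenvalue [mu]. The real kernel of
    [c ^ 2 - mu] is nonzero and invariant under [g], hence is the whole space. *)
Lemma irreducible_commutant_sqr n (g : {vspace 'M[R]_n}) (c : 'M[R]_n) :
  irreducible_linear g -> bounded_mexp c -> (forall x, x \in g -> x *m c = c *m x) ->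
  exists mu : R, c *m c = mu%:M.
Proof.
move=> [n0 irr] bc cg.
have [P Pu /diagonalizable_forPex[d /(simmxP Pu) Pc]] := bounded_mexp_diagonalizable bc.
have d0 := bounded_mexp_spectrum bc Pu Pc.
pose j := Ordinal n0; pose mu := complex.Re (d 0 j * d 0 j); exists mu.
apply/eqP; rewrite -subr_eq0; apply/eqP; set A := c *m c - _.
(* Over C, the nonzero row [row j P] is a left null vector of [A]. *)
have AnU : A \notin unitmx.
  rewrite -(map_unitmx (real_complex R)); apply/negP => Au.
  have : row j P *m map_mx (real_complex R) A = 0.
    rewrite map_mxB map_mxM map_scalar_mx mulmxBr -row_mul mulmxA Pc.
    rewrite -mulmxA Pc mulmxA mulmx_diag row_mul row_diag_mx mul_mx_scalar.
    rewrite -scalemxAl -rowE -scalerBl mxE.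
    have := d0 j; rewrite /mu; case: (d 0 j) => a b /= ->.
    rewrite (_ : (_ * _)%C - _ = 0) ?scale0r //; apply/eqP.
    by rewrite eq_complex /= !mul0r mulr0 addr0 !subrr !eqxx.
  move/(congr1 (fun M => M *m invmx (map_mx (real_complex R) A))).
  rewrite mulmxK // mul0mx rowE => /(congr1 (fun M => M *m invmx P)).
  rewrite mulmxK // mul0mx => /matrixP/(_ 0 j); rewrite !mxE !eqxx.
  by apply/eqP/oner_neq0.
pose f : 'Hom('cV[R]_n, 'cV[R]_n) := linfun (mulmx A).
have fE u : f u = A *m u by rewrite lfunE.
have Ag x : x \in g -> x *m A = A *m x.
  move=> xg; rewrite /A mulmxBr mulmxBl (mulmxA x) (cg x xg) -(mulmxA c x) (cg x xg).
  by rewrite mulmxA scalar_mxC.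
have [x u xg|f0|fT] := irr (lker f).
- rewrite memv_ker fE => /eqP Au; rewrite memv_ker fE.
  by rewrite mulmxA -(Ag x xg) -mulmxA Au mulmx0.
- case/negP: AnU; rewrite -unitmx_tr -row_free_unit -kermx_eq0.
  apply/rowV0P => v /sub_kermxP vA.
  have : v^T \in lker f by rewrite memv_ker fE -[A]trmxK -trmx_mul vA trmx0.
  by rewrite f0 memv0 => /eqP/(congr1 trmx); rewrite trmxK trmx0.
- apply/matrixP => i k; rewrite mxE.
  have : delta_mx k 0 \in lker f by rewrite fT memvf.
  by rewrite memv_ker fE -colE => /eqP/colP/(_ i); rewrite !mxE.
Qed.
End RealDiagonalization.

(** * Conjugation into a centralizer *)

Section Conjugation.
Variables (R : realType) (n : nat).
Local Open Scope classical_set_scope.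
Implicit Types (x y z h a : 'M[R]_n) (G : set 'M[R]_n) (g : {vspace 'M[R]_n}).

Lemma mxtrace_mxbr x y z : \tr (mxbr x y *m z) = \tr (x *m mxbr y z).
Proof.
rewrite /mxbr mulmxBl mulmxBr !raddfB /= mulmxA; congr (_ - _).
by rewrite mxtrace_mulC !mulmxA mxtrace_mulC mulmxA.
Qed.

Lemma cvg_det (T : Type) (F : set_system T) (FF : Filter F) m
    (u : T -> 'M[R]_m) (l : 'M[R]_m) :
  (forall i j, u t i j @[t --> F] --> l i j) -> \det (u t) @[t --> F] --> \det l.
Proof.
move=> ul; apply: cvg_big => [|s _]; first exact: add_continuous.
apply: cvgM; first exact: cvg_cst.
by apply: cvg_big => [|i _]; [exact: mul_continuous | exact: ul].
Qed.

Lemma cvg_adj (T : Type) (F : set_system T) (FF : Filter F) m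
    (u : T -> 'M[R]_m) (l : 'M[R]_m) i j :
  (forall i j, u t i j @[t --> F] --> l i j) ->
  \adj (u t) i j @[t --> F] --> \adj l i j.
Proof.
move=> ul; rewrite mxE (_ : (fun t => _) = fun t => cofactor (u t) j i); last first.
  by apply/funext => t; rewrite mxE.
apply: cvgM; first exact: cvg_cst.
by apply: cvg_det => p q; rewrite !mxE (_ : (fun t => _) = fun t => u t (lift j p) (lift i q));
  [exact: ul | apply/funext => t; rewrite !mxE].
Qed.

(* The trace of [a y a^-1 h], with the inverse spelt out so that continuity in
   [a] is a matter of polynomials. *)
Let conj_trace y h a := (\det a)^-1 * \tr (a *m y *m \adj a *m h).

Let conj_traceE y h a : a \in unitmx ->
  conj_trace y h a = \tr (a *m y *m invmx a *m h).
Proof.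
by move=> au; rewrite /invmx au /conj_trace -scalemxAr -scalemxAl mxtraceZ.
Qed.

Let continuous_conj_trace y h a : a \in unitmx ->
  conj_trace y h @ nbhs a --> conj_trace y h a.
Proof.
move=> au.
have cid i j : (fun b : 'M[R]_n => b i j) @ nbhs a --> a i j by exact: coord_continuous.
apply: cvgM.
  apply: cvgV; first by rewrite -unitfE -unitmxE.
  exact: (@cvg_det _ (nbhs a) _ n (fun b => b) a cid).
have trE b : \tr (b *m y *m \adj b *m h) =
    \sum_i \sum_l (\sum_k (\sum_p b i p * y p k) * \adj b k l) * h l i.
  apply: eq_bigr => i _; rewrite mxE; apply: eq_bigr => l _; rewrite mxE.
  by congr (_ * _); apply: eq_bigr => k _; rewrite mxE.
rewrite trE (_ : (fun t => \tr _) = fun b : 'M[R]_n =>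
  \sum_i \sum_l (\sum_k (\sum_p b i p * y p k) * \adj b k l) * h l i); last first.
  by apply/funext => b; exact: trE.
have cs (I : finType) (f : I -> 'M[R]_n -> R) (l : I -> R) :
    (forall i, f i @ nbhs a --> l i) ->
    (fun b : 'M[R]_n => \sum_i f i b) @ nbhs a --> \sum_i l i.
  by move=> fl; apply: cvg_big => [|i _]; [exact: add_continuous | exact: fl].
apply: (cs _ _ _) => i; apply: (cs _ _ _) => l.
apply: cvgM; last exact: cvg_cst.
apply: (cs _ _ _) => k; apply: cvgM; last exact: (@cvg_adj _ (nbhs a) _ n (fun b => b) a _ _ cid).
by apply: (cs _ _ _) => p; apply: cvgM; [exact: cid | exact: cvg_cst].
Qed.

Lemma mexp_conj a y t : a \in unitmx ->
  mexp (t *: (a *m y *m invmx a)) = a *m mexp (t *: y) *m invmx a.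
Proof.
move=> au; have H := @mexp_intertwine _ _ (a *m y *m invmx a) y a t.
by rewrite -H ?mulmxK // mulmxKV.
Qed.

(** Conjugation by [a] carries the one-parameter group of [y] to that of [a y a^-1], which stays in
    [G]. *)
Lemma compact_group_Ad G g a y : compact_linear_group G ->
  (forall x, x \in g <-> forall t : R, G (mexp (t *: x))) ->
  G a -> y \in g -> a *m y *m invmx a \in g.
Proof.
move=> [Gu _ GM GV _] gG Ga /gG yG; apply/gG => t.
by rewrite mexp_conj ?Gu //; apply: (GM); [apply: (GM) | apply: GV].
Qed.

(* [a] minimises [conj_trace y h] on [G]; differentiate along [exp (s z) a]. *)
Lemma compact_group_conj_critical G g y h : compact_linear_group G ->
  (forall x, x \in g <-> forall t : R, G (mexp (t *: x))) ->
  exists2 a, G a &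
    forall z, z \in g -> \tr (z *m mxbr (a *m y *m invmx a) h) = 0.
Proof.
move=> [Gu G1 GM GV Gc] gG.
have [||a /set_mem Ga amin] := @compact_EVT_min _ R (conj_trace y h) G _ Gc.
- by exists 1%:M.
- apply: continuous_in_subspaceT => a /set_mem Ga.
  exact/continuous_conj_trace/Gu.
exists a => // z /gG zG; set Y := a *m y *m invmx a.
(* This is the trace of [exp (s z) Y exp (- s z) h], expanded into entries so that the scalar sum
   and product rules apply. *)
pose phi s := \sum_i \sum_k (mexp (s *: z) *m Y) i k * (mexp (s *: - z) *m h) k i.
have phiE s : phi s = conj_trace y h (mexp (s *: z) *m a).
  have Gsa : G (mexp (s *: z) *m a) by apply: (GM).
  have sN : invmx (mexp (s *: z)) = mexp (s *: - z).
    have su : mexp (s *: z) \in unitmx by apply: Gu.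
    by rewrite -[RHS](mulKmx su) mexpN mulmx1.
  have aN : invmx (mexp (s *: z) *m a) = invmx a *m mexp (s *: - z).
    have H : (mexp (s *: z) *m a) *m (invmx a *m mexp (s *: - z)) = 1%:M.
      by rewrite mulmxA mulmxK ?Gu // mexpN.
    by rewrite -[RHS](mulKmx (Gu _ Gsa)) H mulmx1.
  rewrite conj_traceE ?Gu // aN.
  have -> : mexp (s *: z) *m a *m y *m (invmx a *m mexp (s *: - z)) *m h =
     (mexp (s *: z) *m Y) *m (mexp (s *: - z) *m h) by rewrite /Y !mulmxA.
  by apply: eq_bigr => i _; rewrite mxE.
pose dphi s := \sum_i \sum_k
  ((mexp (s *: z) *m Y) i k * (mexp (s *: - z) *m (- z *m h)) k i +
   (mexp (s *: z) *m (z *m Y)) i k * (mexp (s *: - z) *m h) k i).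
have dphiP s : is_derive s (1 : R) phi (dphi s).
  apply: is_derive_sumR => i; apply: is_derive_sumR => k.
  have := is_derive_mexp_mul z s Y i k => ?.
  have := is_derive_mexp_mul (- z) s h k i => ?.
  have -> : (fun s => (mexp (s *: z) *m Y) i k * (mexp (s *: - z) *m h) k i) =
    (fun s => (mexp (s *: z) *m Y) i k) * (fun s => (mexp (s *: - z) *m h) k i) by [].
  by apply: is_derive_eq; congr (_ + _); rewrite [LHS]mulrC.
(* All [exp (s z) a] lie in [G], so [s = 0] is an interior minimum on any interval around 0. *)
have phi0 : is_derive (0 : R) (1 : R) phi 0.
  apply: (@derive1_at_min _ phi (-1) 1) => [|t _||t _].
  - lra.
  - by have [] := dphiP t.
  - by rewrite in_itv /=; apply/andP; split; lra.
  - rewrite !phiE scale0r mexp0 mul1mx; apply: (amin); apply/mem_set.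
    by apply: (GM).
have <- : dphi 0 = 0.
  by have [_ <-] := dphiP 0; have [_] := phi0.
rewrite /dphi !scale0r mexp0 !mul1mx.
transitivity (\tr (Y *m (- z *m h)) + \tr (z *m Y *m h)).
  rewrite /mxbr mulmxBr raddfB /= addrC; congr (_ + _); last by rewrite mulmxA.
  by rewrite mulNmx mulmxN raddfN /= [in RHS]mxtrace_mulC mulmxA.
rewrite /mxtrace -big_split /=; apply: eq_bigr => i _.
by rewrite mxE [X in _ + X]mxE -big_split.
Qed.
End Conjugation.

(** * Adjoint algebras *)

Section CompactLieAlgebra.
Variables (R : realType) (n : nat) (g : {vspace 'M[R]_n}).
Hypothesis g_compact : compact_linear_lie_algebra g.

Lemma compact_lie_bounded_mexp x : x \in g -> bounded_mexp x.
Proof.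
have [G [_ _ _ _ Gc] gG] := g_compact => /gG xG.
have [M HM] := compact_mx_bounded Gc.
by exists M => t i j; apply: HM; exact: xG.
Qed.

Lemma compact_lie_trace_sqr x : x \in g -> \tr (x *m x) <= 0 ?= iff (x == 0).
Proof. by move=> /compact_lie_bounded_mexp; exact: bounded_mexp_trace_sqr. Qed.

Lemma compact_lie_trace_eq0 x : x \in g -> \tr (x *m x) = 0 -> x = 0.
Proof. by move=> /compact_lie_trace_sqr[_ E] /eqP; rewrite E => /eqP. Qed.
End CompactLieAlgebra.

(** * Matrix brackets and maximal commutative subalgebras *)

Section MatrixBracket.
Variables (K : fieldType) (n : nat).
Implicit Types (x y z : 'M[K]_n) (g t : {vspace 'M[K]_n}).

Lemma mxbrZl a x y : mxbr (a *: x) y = a *: mxbr x y.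
Proof. by rewrite /mxbr -scalemxAl -scalemxAr scalerBr. Qed.

Lemma mxbrZr a x y : mxbr x (a *: y) = a *: mxbr x y.
Proof. by rewrite /mxbr -scalemxAl -scalemxAr scalerBr. Qed.

Lemma mxbrDl x y z : mxbr (x + y) z = mxbr x z + mxbr y z.
Proof. by rewrite /mxbr mulmxDl mulmxDr opprD addrACA. Qed.

Lemma mxbrDr x y z : mxbr z (x + y) = mxbr z x + mxbr z y.
Proof. by rewrite /mxbr mulmxDl mulmxDr opprD addrACA. Qed.

Lemma mxbrxx x : mxbr x x = 0. Proof. exact: subrr. Qed.

Lemma mxbrN x y : mxbr x y = - mxbr y x. Proof. by rewrite /mxbr opprB. Qed.

Lemma mxbr_eq0 x y : mxbr x y = 0 <-> x *m y = y *m x.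
Proof. by rewrite /mxbr; split=> [/eqP|->]; rewrite ?subrr // subr_eq0 => /eqP. Qed.

Lemma lie_commutative_adjoin t y : lie_commutative (@mxbr K n) t ->
  (forall x, x \in t -> mxbr x y = 0) ->
  lie_commutative (@mxbr K n) (t + <[y]>).
Proof.
move=> tc ty x1 x2 /memv_addP[u ut [_ /vlineP[a ->] ->]].
move=> /memv_addP[v vt [_ /vlineP[b ->] ->]].
rewrite mxbrDl !mxbrDr !mxbrZl !mxbrZr tc // ty // [mxbr y v]mxbrN ty // mxbrxx.
by rewrite oppr0 !scaler0 !addr0.
Qed.

(** Adjoining [y] to [t] keeps it commutative, so maximality absorbs [y]. *)
Lemma maximal_commutative_centralizer g t y :
  maximal_commutative (@mxbr K n) g t -> y \in g ->
  (forall x, x \in t -> mxbr x y = 0) -> y \in t.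
Proof.
move=> [tg tc tmax] yg ty.
rewrite -(tmax (t + <[y]>)%VS); first by rewrite (subvP (addvSr _ _)) // memv_line.
- by rewrite subv_add tg -memvE.
- exact: lie_commutative_adjoin.
- exact: addvSl.
Qed.

Lemma dimv1_line g : \dim g = 1%N -> exists2 h, h != 0 & g = <[h]>%VS.
Proof.
move=> dg; have h0 : vpick g != 0 by rewrite vpick0 -dimv_eq0 dg.
exists (vpick g) => //; apply/esym/eqP.
by rewrite eqEdim -memvE memv_pick dim_vline h0 dg.
Qed.
End MatrixBracket.

(** * Rank one and stabilizers in adjoint algebras *)

Section RankOne.
Variables (R : realType) (n : nat) (g : {vspace 'M[R]_n}).
Hypotheses (g_sub : lie_subalgebra (@mxbr R n) g)
  (g_compact : compact_linear_lie_algebra g).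

(** The line [t = <[h]>] is the centralizer of [h] in [g]. If [t'] contained independent [y1] and
    [y2], some conjugation would carry [y1] to a nonzero multiple of [h]; the conjugate of [y2]
    commutes with it, hence lies on the same line. *)
Lemma compact_lie_rank_one t t' :
  maximal_commutative (@mxbr R n) g t -> \dim t = 1%N ->
  (t' <= g)%VS -> lie_commutative (@mxbr R n) t' -> (\dim t' <= 1)%N.
Proof.
move=> tmax /dimv1_line[h h0 tE] t'g t'c; rewrite leqNgt; apply/negP => dt'.
have hg : h \in g.
  by have [/subvP tg _ _] := tmax; apply: tg; rewrite tE memv_line.
have hcent y : y \in g -> mxbr h y = 0 -> y \in <[h]>%VS.
  move=> yg hy; rewrite -tE; apply: (maximal_commutative_centralizer tmax) => // x.
  by rewrite tE => /vlineP[c ->]; rewrite mxbrZl hy scaler0.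
have y1t := memv_pick t'; set y1 := vpick t' in y1t.
have y10 : y1 != 0 by rewrite vpick0 -dimv_eq0 -lt0n (ltn_trans _ dt').
have /subvPn[y2 y2t /negP[]] : ~~ (t' <= <[y1]>)%VS.
  by apply/negP => /dimvS; rewrite dim_vline y10 leqNgt dt'.
have [G cG gG] := g_compact.
have [a Ga acrit] := compact_group_conj_critical y1 h cG gG.
have au : a \in unitmx by have [Gu _ _ _ _] := cG; exact: Gu.
set Ad := fun y => a *m y *m invmx a.
have Adg y : y \in t' -> Ad y \in g.
  by move=> yt'; apply: (compact_group_Ad cG gG Ga); apply: (subvP t'g).
have AdK y : invmx a *m Ad y *m a = y.
  by rewrite /Ad !mulmxA mulVmx // mul1mx mulmxKV.
(* The bracket lies in [g] and is trace-orthogonal to [g], in particular to itself. *)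
have : mxbr (Ad y1) h = 0.
  apply: (compact_lie_trace_eq0 g_compact); first by apply: g_sub => //; exact: Adg.
  by apply: acrit; apply: g_sub => //; exact: Adg.
rewrite mxbrN => /eqP; rewrite oppr_eq0 => /eqP.
move=> /(hcent _ (Adg _ y1t)) /vlineP[c1 Ay1].
have c10 : c1 != 0.
  apply: contraNneq y10 => c0.
  by rewrite -(AdK y1) Ay1 c0 scale0r mulmx0 mul0mx.
have : mxbr (Ad y1) (Ad y2) = 0.
  have y12 := t'c _ _ y1t y2t; apply/mxbr_eq0; move/mxbr_eq0 : y12 => y12.
  rewrite /Ad !mulmxA !mulmxKV // -!(mulmxA a).
  by rewrite y12.
rewrite Ay1 mxbrZl => /eqP; rewrite scaler_eq0 (negPf c10) => /eqP.
move=> /(hcent _ (Adg _ y2t)) /vlineP[c2 Ay2].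
apply/vlineP; exists (c2 / c1).
rewrite -[LHS]AdK -[in RHS](AdK y1) Ay1 Ay2.
by rewrite -!scalemxAr -!scalemxAl scalerA divfK.
Qed.

Lemma linear_col_matrix (f : 'cV[R]_n -> 'cV[R]_n) :
  (forall a u v, f (a *: u + v) = a *: f u + f v) ->
  exists A : 'M[R]_n, forall u, A *m u = f u.
Proof.
move=> lf; exists (\matrix_(i, j) f (delta_mx j 0) i 0) => u.
have fD v w : f (v + w) = f v + f w by rewrite -[v]scale1r lf !scale1r.
have f0 : f 0 = 0 by apply: (addrI (f 0)); rewrite -fD !addr0.
have fZ a v : f (a *: v) = a *: f v by rewrite -[a *: v]addr0 lf f0 addr0.
have -> : f u = \sum_j u j 0 *: f (delta_mx j 0).
  rewrite {1}[u]matrix_sum_delta (big_morph f fD f0).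
  by apply: eq_bigr => j _; rewrite big_ord1 fZ.
apply/colP => i; rewrite mxE summxE; apply: eq_bigr => j _.
by rewrite !mxE mulrC.
Qed.

(** For [v = phi u], the stabilizer of [v] is the centralizer in [g] of [A], the image of [ad u]. So
    [A] lies in [t], and every commutative subalgebra of [g] containing [t] already lies in the
    stabilizer. *)
Lemma adjoint_stabilizer_maximal v t :
  adjoint_simple g -> maximal_commutative (@mxbr R n) (stabilizer g v) t ->
  maximal_commutative (@mxbr R n) g t.
Proof.
move=> [S [br [phi [[brDr brDl brxx brJ] [Snc Sid] [phi0 phiT] gad]]]] tmax.
have phiK : cancel phi (phi^-1)%VF by apply/lker0_lfunK; rewrite phi0.
have phiVK : cancel (phi^-1)%VF phi.
  by move=> w; apply: limg_lfunVK; rewrite phiT memvf.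
pose u := (phi^-1)%VF v; have vE : v = phi u by rewrite phiVK.
have brZ w a z : br w (a *: z) = a *: br w z.
  have := brDr w a z 0; have br0 : br w 0 = 0.
    by have := brDr w (-1) 0 0; rewrite scaleN1r oppr0 addr0 scaleN1r addNr.
  by rewrite !addr0 br0 addr0.
have [A AE] : exists A : 'M[R]_n, forall w, A *m w = phi (br u ((phi^-1)%VF w)).
  by apply: linear_col_matrix => a w1 w2; rewrite linearP brDr linearP.
have Aphi w : A *m phi w = phi (br u w) by rewrite AE phiK.
have stabP x : (x \in stabilizer g v) = (x \in g) && (x *m v == 0).
  by rewrite /stabilizer memv_cap memv_ker lfunE.
have Ag : A \in g by apply/gad; exists u.
have eq_mx (x y : 'M[R]_n) : (forall w, x *m phi w = y *m phi w) -> x = y.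
  move=> xy; apply/matrixP => i j; have := xy ((phi^-1)%VF (delta_mx j 0)).
  by rewrite phiVK -!colE => /colP/(_ i); rewrite !mxE.
have brN w z : br w z = - br z w.
  have brD1 a b c : br (a + b) c = br a c + br b c.
    by rewrite -{1}[a]scale1r brDl scale1r.
  have brD2 a b c : br c (a + b) = br c a + br c b.
    by rewrite -{1}[a]scale1r brDr scale1r.
  have := brxx (w + z); rewrite brD1 !brD2 !brxx add0r addr0 => /eqP.
  by rewrite addr_eq0 => /eqP.
have brNr w z : br w (- z) = - br w z by rewrite -scaleN1r brZ scaleN1r.
have br0l w : br 0 w = 0 by rewrite brN -(scale0r (0 : S)) brZ !scale0r oppr0.
(* [x = ad y] kills [phi u] iff [br y u = 0] iff [x] commutes with [A = ad u]. *)
have commA x y : (forall w, x *m phi w = phi (br y w)) ->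
    forall w, mxbr A x *m phi w = phi (br (br u y) w).
  move=> xE w; rewrite /mxbr mulmxBl -!mulmxA Aphi xE xE Aphi -linearB; congr (phi _).
  have := brJ u y w; rewrite [br w (br u y)]brN [br w u]brN.
  by rewrite brNr => /eqP; rewrite subr_eq0 => /eqP.
(* A central element spans an ideal; by simplicity it is zero, since otherwise its line would be all
   of [S] and [S] would be commutative. *)
have ad0 y : (forall w, br y w = 0) -> y = 0.
  move=> yc; have [|Z0|yT] := Sid <[y]>%VS.
  - split; first exact: subvf.
    by move=> x z _ /vlineP[c ->]; rewrite brZ brN yc oppr0 scaler0 mem0v.
  - by have := memv_line y; rewrite Z0 memv0 => /eqP.
  - case: Snc => x z _ _; have : x \in <[y]>%VS by rewrite yT memvf.
    by move=> /vlineP[c ->]; rewrite brN brZ brN yc oppr0 scaler0 oppr0.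
have [/subvP ts tc tM] := tmax.
have At : A \in t.
  apply: (maximal_commutative_centralizer tmax) => [|x /ts].
    by rewrite stabP Ag vE Aphi brxx raddf0 eqxx.
  rewrite stabP => /andP[/gad[y xE] /eqP xv].
  apply: eq_mx => w; rewrite mxbrN mulNmx (commA _ _ xE) mul0mx.
  have yu : br y u = 0.
    by apply: (can_inj phiK); rewrite -xE -vE xv raddf0.
  by rewrite [br u y]brN yu oppr0 br0l raddf0 oppr0.
split=> [||t' t'g t'c tt'].
- apply/subvP => x xt; have := ts _ xt.
  by rewrite stabP => /andP[].
- exact: tc.
- apply: tM => //; apply/subvP => x xt'.
  rewrite stabP (subvP t'g) //=.
  have /gad[y xE] := subvP t'g x xt'.
  have Ax : mxbr A x = 0 by apply: t'c => //; apply: (subvP tt').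
  have : br u y = 0.
    apply: ad0 => w; apply: (can_inj phiK).
    by rewrite -(commA x y xE) Ax mul0mx raddf0.
  by rewrite brN => /eqP; rewrite oppr_eq0 vE xE => /eqP ->; rewrite raddf0.
Qed.

Lemma adjoint_stabilizer_rank_neq1 t1 v : maximal_commutative (@mxbr R n) g t1 ->
  (1 < \dim t1)%N -> adjoint_simple g -> ~ has_rank (@mxbr R n) (stabilizer g v) 1.
Proof.
move=> [t1g t1c _] dt1 gad [t tmax dt].
have := compact_lie_rank_one (adjoint_stabilizer_maximal gad tmax) dt t1g t1c.
by rewrite leqNgt dt1.
Qed.
End RankOne.

(** * The commutator subalgebra *)

Section Commutator.
Variables (K : fieldType) (n : nat).
Implicit Types (x y z : 'M[K]_n) (g t : {vspace 'M[K]_n}).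

Lemma mxbr_suml (I : Type) (s : seq I) (F : I -> 'M[K]_n) y :
  mxbr (\sum_(i <- s) F i) y = \sum_(i <- s) mxbr (F i) y.
Proof. by rewrite /mxbr mulmx_suml mulmx_sumr -sumrB. Qed.

Lemma mxbr_sumr (I : Type) (s : seq I) (F : I -> 'M[K]_n) y :
  mxbr y (\sum_(i <- s) F i) = \sum_(i <- s) mxbr y (F i).
Proof. by rewrite /mxbr mulmx_suml mulmx_sumr -sumrB. Qed.

Lemma mem_lie_commutator g x y : x \in g -> y \in g ->
  mxbr x y \in lie_commutator (@mxbr K n) g.
Proof.
move=> xg yg; rewrite (coord_vbasis xg) (coord_vbasis yg) mxbr_suml.
apply: memv_suml => i _; rewrite mxbr_sumr; apply: memv_suml => j _.
rewrite mxbrZl mxbrZr; do 2 apply: memvZ; apply: memv_span.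
by apply/allpairsP; exists ((vbasis g)`_i, (vbasis g)`_j);
  rewrite /= !mem_nth ?size_tuple.
Qed.

(** The induction principle for the commutator subalgebra: it hides the basis in its definition and
    leaves only arbitrary brackets to treat. *)
Lemma lie_commutator_ind g (P : 'M[K]_n -> Prop) :
  P 0 -> (forall a x y, P x -> P y -> P (a *: x + y)) ->
  (forall x y, x \in g -> y \in g -> P (mxbr x y)) ->
  forall x, x \in lie_commutator (@mxbr K n) g -> P x.
Proof.
move=> P0 PD PB x; rewrite /lie_commutator => /(coord_span (X := in_tuple _)) ->.
apply: (big_ind P) => // [u v Pu Pv|i _]; first by rewrite -[u]scale1r; apply: PD.
rewrite -[X in P X]addr0; apply: PD => //.
have /allpairsP[[a b] [/= /vbasis_mem ag /vbasis_mem bg ->]] :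
    [seq mxbr x y | x <- vbasis g, y <- vbasis g]`_i \in
    [seq mxbr x y | x <- vbasis g, y <- vbasis g] by apply: mem_nth.
exact: PB.
Qed.

Lemma lie_commutator_sub g t :
  (forall x y, x \in g -> y \in g -> mxbr x y \in t) ->
  (lie_commutator (@mxbr K n) g <= t)%VS.
Proof.
move=> gt; apply/subvP; apply: lie_commutator_ind => // [|a x y xt yt].
  exact: mem0v.
by rewrite memvD // memvZ.
Qed.

Lemma mxbr_jacobi x y z : mxbr x (mxbr y z) - mxbr y (mxbr x z) = mxbr (mxbr x y) z.
Proof.
rewrite /mxbr !(mulmxBl, mulmxBr) !mulmxA !opprB.
set a := x *m y *m z; set b := x *m z *m y; set c := y *m z *m x.
set d := z *m y *m x; set e := y *m x *m z; set f := z *m x *m y.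
clearbody a b c d e f; apply/matrixP => i j; rewrite !mxE; ring.
Qed.
End Commutator.

Lemma exists_hom (K : fieldType) (U V : vectType K) (f : U -> V) :
  linear f -> exists F : 'Hom(U, V), forall u, F u = f u.
Proof.
move=> lf; pose f' : {linear U -> V} :=
  HB.pack f (GRing.isLinear.Build K U V *:%R f lf).
by exists (linfun f') => u; rewrite lfunE.
Qed.

(* The complement is the annihilator of [k], cut out by [\dim k] equations. *)
Lemma anisotropic_decomposition (K : fieldType) (E : vectType K)
    (B : E -> E -> K) (g k : {vspace E}) :
  (forall y, linear (B^~ y : E -> K^o)) -> (forall x, linear (B x : E -> K^o)) ->
  (k <= g)%VS -> (forall x, x \in k -> B x x = 0 -> x = 0) ->
  forall y, y \in g -> exists2 x, x \in k & forall z, z \in k -> B (y - x) z = 0.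
Proof.
move=> linl linr kg aniso y yg.
have [F FE] : exists F : 'Hom(E, 'rV[K]_(\dim k)),
    forall x, F x = \row_j B x (vbasis k)`_j.
  apply: exists_hom => a u v; apply/rowP => j; rewrite !mxE.
  exact: linl.
have B0 x : B x 0 = 0.
  have := linr x 1 0 0; rewrite !scale1r addr0 => /eqP.
  by rewrite -subr_eq0 opprD addrA subrr sub0r oppr_eq0 => /eqP.
have kerP x : x \in lker F -> forall z, z \in k -> B x z = 0.
  rewrite memv_ker FE => /eqP/rowP Fx z zk; rewrite (coord_vbasis zk).
  apply: (big_ind (fun z => B x z = 0)) => // [u v Bu Bv|j _].
    by rewrite -[u]scale1r linr Bu Bv scaler0 addr0.
  by have := Fx j; rewrite !mxE -[_ *: _]addr0 linr B0 addr0 => ->; rewrite scaler0.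
have cap0 : (k :&: (g :&: lker F) = 0)%VS.
  apply/eqP; rewrite -subv0; apply/subvP => x; rewrite !memv_cap => /and3P[xk _ xF].
  by rewrite memv0; apply/eqP/aniso => //; exact: kerP.
have : (g <= k + g :&: lker F)%VS.
  have /eqP -> // : (k + g :&: lker F == g)%VS.
  rewrite eqEdim subv_add kg capvSl dimv_disjoint_sum //=.
  rewrite -(limg_ker_dim F g) addnC leq_add2r.
  by apply: leq_trans (dimvS (subvf _)) _; rewrite dimvf /dim /= mul1n.
move=> /subvP/(_ y yg)/memv_addP[x xk [w]]; rewrite memv_cap => /andP[_ /kerP wF] ->.
by exists x => // z /wF; rewrite addrC addKr.
Qed.

(** * Vertices of the weight polyhedron *)

Section Vertex.
Variables (R : realType) (E : vectType R) (t : {vspace E}) (I : finType).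
Implicit Types (l : I -> E -> R) (h d : E).

Lemma exists_notin (s : seq R) : exists c, c \notin s.
Proof.
exists (1 + \sum_(x <- s) `|x|); apply/negP => cs.
have := ler_norm (1 + \sum_(x <- s) `|x|).
rewrite leNgt => /negP[]; have : \sum_(x <- s) `|x| >= `|1 + \sum_(x <- s) `|x| |.
  rewrite [leRHS](big_rem _ cs) /= lerDl; exact: sumr_ge0.
by move=> /le_lt_trans -> //; rewrite ltrDr.
Qed.

(** The forms are treated one at a time: if the next one vanishes at [h] but not on [t], a generic
    multiple of a vector off its kernel is added to [h]. *)
Lemma exists_regular l : (forall i, linear (l i : E -> R^o)) ->
  exists2 h, h \in t & forall i, (forall x, x \in t -> l i x = 0) \/ l i h != 0.
Proof.
move=> linl; have lD i c x y : l i (x + c *: y) = l i x + c * l i y.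
  by rewrite addrC linl addrC.
suff H (s : seq I) : exists2 h, h \in t &
    forall i, i \in s -> (forall x, x \in t -> l i x = 0) \/ l i h != 0.
  by have [h ht hs] := H (enum I); exists h => // i; apply: hs; rewrite mem_enum.
elim: s => [|j s [h ht hs]]; first by exists 0; [exact: mem0v|].
have [l0|nl0] := pselect (forall x, x \in t -> l j x = 0).
  by exists h => // i; rewrite inE => /orP[/eqP ->|/hs //]; left.
have [lh|lh] := eqVneq (l j h) 0; last first.
  by exists h => // i; rewrite inE => /orP[/eqP ->|/hs //]; right.
have [d [dt ld]] : exists d, d \in t /\ l j d != 0.
  apply: contrapT => H; apply: nl0 => x xt; apply/eqP; apply: contrapT => lx.
  by apply: H; exists x; split=> //; apply/negP.
have [c] := exists_notin (0 :: [seq - l i h / l i d | i <- s]).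
rewrite inE negb_or => /andP[c0 cs].
exists (h + c *: d); first by rewrite memvD // memvZ.
move=> i; rewrite inE => /orP[/eqP ->|si].
  by right; rewrite lD lh add0r mulf_neq0.
have [l0|lih] := hs i si; [by left | right].
rewrite lD; apply: contra cs => /eqP E0; apply/mapP; exists i => //.
have lid : l i d != 0.
  by apply: contraNneq lih => l0; move: E0; rewrite l0 mulr0 addr0 => ->.
by apply: (mulIf lid); rewrite divfK //; apply/eqP; rewrite -addr_eq0 addrC E0.
Qed.

(* A feasible point with the largest number of active constraints. *)
Lemma exists_vertex l (A : pred I) h0 : (forall i, linear (l i : E -> R^o)) ->
  h0 \in t -> (forall i, A i -> 1 <= l i h0) ->
  (forall d, d \in t -> (forall i, A i -> l i d = 0) -> d = 0) ->
  exists2 h, h \in t & (forall i, A i -> 1 <= l i h) /\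
    forall d, d \in t -> (forall i, A i -> l i h = 1 -> l i d = 0) -> d = 0.
Proof.
move=> linl h0t h0f sep; have lD i c x y : l i (x + c *: y) = l i x + c * l i y.
  by rewrite addrC linl addrC.
pose feas h := h \in t /\ forall i, A i -> 1 <= l i h.
pose act h := #|[set i | A i && (l i h == 1)]|.
have [m [h [ht hf] hm] mmax] : exists2 m, (exists2 h, feas h & act h = m) &
    forall h, feas h -> (act h <= m)%N.
  pose Q m := `[< exists2 h, feas h & act h = m >].
  have Q0 : exists m, Q m by exists (act h0); apply/asboolP; exists h0.
  have Qb m : Q m -> (m <= #|I|)%N.
    by move=> /asboolP[h _ <-]; exact: max_card.
  case: (ex_maxnP Q0 Qb) => m /asboolP Qm mM; exists m => // h fh.
  by apply: mM; apply/asboolP; exists h.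
exists h => //; split=> // d dt dact; apply: contrapT => d0.
(* If the active constraints are constant along [e] and some constraint decreases, the ray from [h]
   stays feasible up to the least [r i], the time at which constraint [i] becomes active. The point
   reached has more active constraints than the maximum allows. *)
have step e : e \in t -> (forall i, A i -> l i h = 1 -> l i e = 0) ->
    (exists2 j, A j & l j e < 0) -> False.
  move=> et eact [j0 Aj0 lj0].
  pose B : pred I := fun i => A i && (l i e < 0).
  have Bj0 : B j0 by rewrite /B Aj0.
  pose r i := (l i h - 1) / (- l i e).
  have [j /andP[Aj lje] jmin] : exists2 j, B j & forall i, B i -> r j <= r i.
    by case: (arg_minP r Bj0) => j Bj jmin; exists j.
  have ljE : l j (h + r j *: e) = 1.
    rewrite lD /r invrN mulrN mulNr divfK ?lt_eqF //; lra.
  have rj0 : 0 <= r j.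
    by apply: divr_ge0; [rewrite subr_ge0 hf | rewrite oppr_ge0 ltW].
  have ljh : l j h != 1.
    by apply/eqP => /(eact _ Aj) ljq; rewrite ljq ltxx in lje.
  have fh' : feas (h + r j *: e).
    split; first by rewrite memvD // memvZ.
    move=> i Ai; rewrite lD; have [lie|lie] := ltP (l i e) 0.
      have : r j <= r i by apply: jmin; rewrite /B Ai.
      rewrite {2}/r ler_pdivlMr ?oppr_gt0 // => H; lra.
    by apply: (le_trans (hf _ Ai)); rewrite lerDl mulr_ge0.
  have := mmax _ fh'; rewrite leqNgt => /negP; apply.
  rewrite -hm /act; apply: proper_card; apply/properP; split; last first.
    by exists j; rewrite !inE Aj ?ljE ?eqxx //= (negPf ljh).
  apply/fintype.subsetP => i; rewrite !inE => /andP[Ai /eqP lih].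
  by rewrite Ai lD lih (eact _ Ai lih) mulr0 addr0 eqxx.
have [j [Aj lj]] : exists j, A j /\ l j d != 0.
  apply: contrapT => H; apply: d0; apply: sep => // i Ai; apply/eqP.
  by apply: contrapT => lid; apply: H; exists i; split=> //; apply/negP.
(* Some constraint decreases along [d] or along [- d]. *)
have [ljn|ljp|/eqP] := ltgtP (l j d) 0; last by rewrite (negPf lj).
  by apply: (step d) => //; exists j.
have lN i : l i (- d) = - l i d.
  have := lD i (-1) 0 d; have := lD i 0 0 0; rewrite !scaleN1r !scale0r !add0r.
  by rewrite mul0r addr0 => _ ->; have := lD i (-1) 0 0; rewrite scaler0 addr0; lra.
apply: (step (- d)); first by rewrite memvN.
  by move=> i Ai lih; rewrite lN (dact i Ai lih) oppr0.
by exists j => //; rewrite lN oppr_lt0.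
Qed.

(* Signing the weights by a regular element makes the vertex avoid every wall,
   and the symmetry of the weights turns active constraints [-1] into [1]. *)
Lemma exists_spanning_regular l : (forall i, linear (l i : E -> R^o)) ->
  (forall i, exists j, forall x, x \in t -> l j x = - l i x) ->
  (forall d, d \in t -> (forall i, l i d = 0) -> d = 0) ->
  exists2 h, h \in t &
    (forall i, (forall x, x \in t -> l i x = 0) \/ l i h != 0) /\
    forall d, d \in t -> (forall i, l i h = 1 -> l i d = 0) -> d = 0.
Proof.
move=> linl sym sep; have [h0 h0t h0r] := exists_regular linl.
pose A i := l i h0 != 0; pose l' i x := Num.sg (l i h0) * l i x.
have sg0 i : A i -> Num.sg (l i h0) != 0 by rewrite sgr_eq0.
have lZ i c x : l i (c *: x) = c * l i x.
  have := linl i c x 0; rewrite addr0 => ->.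
  by have := linl i 1 0 0; rewrite !scale1r addr0 /GRing.scale /=; lra.
have linl' i : linear (l' i : E -> R^o).
  by move=> c x y; rewrite /l' linl /GRing.scale /=; ring.
(* This multiple of [h0] is feasible, since [c] exceeds the inverse of each nonzero absolute value.
   Forms vanishing at [h0] contribute 0, the inverse of 0 being 0. *)
pose c := 1 + \sum_i `|l i h0|^-1.
have [|||h ht [hf hv]] := @exists_vertex l' A (c *: h0) linl'.
- by rewrite memvZ.
- move=> i Ai; rewrite /l' lZ mulrCA -normrEsg.
  have a0 : 0 < `|l i h0| by rewrite normr_gt0.
  rewrite -ler_pdivrMr // mul1r /c (bigD1 i) //= addrCA lerDl addr_ge0 //.
  by apply: sumr_ge0 => ? _; rewrite invr_ge0.
- move=> d dt H; apply: sep => // i; have [l0|lh0] := h0r i; first exact: l0.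
  by have /eqP := H i lh0; rewrite mulf_eq0 (negPf (sg0 _ lh0)) => /eqP.
exists h => //; split=> [i|d dt H].
  have [l0|lh0] := h0r i; [by left | right].
  have := hf i lh0; rewrite /l'; apply: contraTneq => ->.
  by rewrite mulr0 -ltNge ltr01.
apply: hv => // i Ai; rewrite /l'; case: sgrP Ai; rewrite /A => l0; rewrite ?l0 ?eqxx // => _.
  by rewrite !mul1r => /H.
(* For a negative sign, activity means [l i h = -1]; the opposite form [l j] then takes the value 1
   at [h]. *)
rewrite !mulN1r => lh; have [j jE] := sym i.
by rewrite -jE // H // jE.
Qed.
End Vertex.

(** * Invariant complex structures *)

Section InvariantComplexStructure.
Variables (R : realType) (n : nat) (g : {vspace 'M[R]_n}) (J : 'M[R]_n).
Hypotheses (g_sub : lie_subalgebra (@mxbr R n) g) (g_sl : in_sl g)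
  (g_compact : compact_linear_lie_algebra g) (g_irr : irreducible_linear g)
  (JJ : J *m J = - 1%:M) (Jg : forall x, x \in g -> J *m x = x *m J).
Implicit Types (x y z a b h : 'M[R]_n).

Let k := lie_commutator (@mxbr R n) g.
Let gJ := complex_span J g.
Let s := lie_commutator (@mxbr R n) gJ.

Lemma complex_spanP x :
  x \in gJ <-> exists a b, [/\ a \in g, b \in g & x = a + J *m b].
Proof.
split=> [/memv_addP[a ag [_ /memv_imgP[b bg ->] ->]]|[a [b [ag bg ->]]]].
  by exists a, b; split=> //; rewrite lfunE.
apply/memv_addP; exists a => //; exists (J *m b) => //.
by apply/memv_imgP; exists b => //; rewrite lfunE.
Qed.

Lemma sub_complex_span x : x \in g -> x \in gJ.
Proof.
by move=> xg; apply/complex_spanP; exists x, 0; rewrite mem0v mulmx0 addr0.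
Qed.

Lemma complex_span_mulJ x : x \in gJ -> J *m x \in gJ.
Proof.
move=> /complex_spanP[a [b [ag bg ->]]]; apply/complex_spanP.
by exists (- b), a; rewrite memvN mulmxDr mulmxA JJ mulNmx mul1mx addrC.
Qed.

Lemma complex_span_commJ x : x \in gJ -> J *m x = x *m J.
Proof.
move=> /complex_spanP[a [b [ag bg ->]]].
by rewrite mulmxDr mulmxDl (Jg ag) -[J *m b *m J]mulmxA -(Jg bg).
Qed.

Lemma mxbr_mulJl x y : y \in gJ -> mxbr (J *m x) y = J *m mxbr x y.
Proof.
by move=> yg; rewrite /mxbr mulmxBr !mulmxA -(complex_span_commJ yg).
Qed.

Lemma mxbr_mulJr x y : x \in gJ -> mxbr x (J *m y) = J *m mxbr x y.
Proof. by move=> xg; rewrite mxbrN mxbr_mulJl // [mxbr y x]mxbrN mulmxN opprK. Qed.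

Lemma complex_span_mxbr x y : x \in gJ -> y \in gJ -> mxbr x y \in gJ.
Proof.
move=> /[dup] xg /complex_spanP[a [b [ag bg xE]]] /complex_spanP[c [d [cg dg ->]]].
rewrite mxbrDr mxbr_mulJr // xE !mxbrDl.
have cJ := sub_complex_span cg; have dJ := sub_complex_span dg.
rewrite !mxbr_mulJl // memvD // ?complex_span_mulJ // memvD //.
- by apply: sub_complex_span; apply: g_sub.
- by apply: complex_span_mulJ; apply: sub_complex_span; apply: g_sub.
- by apply: sub_complex_span; apply: g_sub.
- by apply: complex_span_mulJ; apply: sub_complex_span; apply: g_sub.
Qed.

Lemma derived_sub x : x \in s -> x \in gJ.
Proof. exact/subvP/lie_commutator_sub/complex_span_mxbr. Qed.

Lemma derived_mulJ x : x \in s -> J *m x \in s.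
Proof.
move: x; apply: lie_commutator_ind => [|a x y xs ys|x y xg yg].
- by rewrite mulmx0 mem0v.
- by rewrite mulmxDr -scalemxAr memvD // memvZ.
- by rewrite -mxbr_mulJl //; apply: mem_lie_commutator => //; exact: complex_span_mulJ.
Qed.

Lemma compact_derived_sub x : x \in k -> x \in s.
Proof.
move: x; apply/subvP/lie_commutator_sub => x y xg yg.
by apply: mem_lie_commutator; exact: sub_complex_span.
Qed.

Lemma compact_derived_sub_g x : x \in k -> x \in g.
Proof. exact/subvP/lie_commutator_sub. Qed.

(** The traces of [a ^ 2] and [b ^ 2] are both nonpositive and opposite to each other, so they
    vanish. This makes the sum [g + J g] direct. *)
Lemma mulJ_disjoint a b : a \in g -> b \in g -> a = J *m b -> b = 0.
Proof.
move=> ag bg aE.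
have aa : a *m a = - (b *m b).
  rewrite aE -[LHS]mulmxA (mulmxA b) -(Jg bg) -[J *m b *m b]mulmxA.
  by rewrite (mulmxA J J) JJ mulNmx mul1mx.
have [ta _] := compact_lie_trace_sqr g_compact ag.
have [tb _] := compact_lie_trace_sqr g_compact bg.
apply: (compact_lie_trace_eq0 g_compact bg); apply/eqP; rewrite eq_le tb /=.
by move: ta; rewrite aa raddfN /= oppr_le0.
Qed.

(** Tested against [a - J b], the form gives the trace of [a ^ 2 + b ^ 2], which is negative unless
    [a = b = 0]. *)
Lemma complex_span_trace_nondeg x : x \in gJ ->
  (forall y, y \in gJ -> \tr (x *m y) = 0) -> x = 0.
Proof.
move=> /complex_spanP[a [b [ag bg ->]]] H.
have : \tr ((a + J *m b) *m (a - J *m b)) = 0.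
  apply: H; apply/complex_spanP; exists a, (- b).
  by rewrite memvN mulmxN.
rewrite mulmxDl !mulmxBr.
have -> : J *m b *m (J *m b) = - (b *m b).
  rewrite -[LHS]mulmxA (mulmxA b) -(Jg bg) -[J *m b *m b]mulmxA.
  by rewrite (mulmxA J J) JJ mulNmx mul1mx.
have E : \tr (a *m (J *m b)) = \tr (J *m b *m a) by rewrite mxtrace_mulC.
rewrite opprK !raddfD /= raddfN /= E => tab.
have [ta _] := compact_lie_trace_sqr g_compact ag.
have [tb _] := compact_lie_trace_sqr g_compact bg.
have ta0 : \tr (a *m a) = 0 by move: ta tb tab; lra.
have tb0 : \tr (b *m b) = 0 by move: ta tb tab; lra.
rewrite (compact_lie_trace_eq0 g_compact ag ta0).
by rewrite (compact_lie_trace_eq0 g_compact bg tb0) mulmx0 addr0.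
Qed.

Lemma central_sqr_scalar c : c \in g -> (forall x, x \in g -> mxbr x c = 0) ->
  exists mu : R, c *m c = mu%:M.
Proof.
move=> cg cc; apply: (irreducible_commutant_sqr g_irr).
  exact: (compact_lie_bounded_mexp g_compact).
by move=> x /cc /mxbr_eq0.
Qed.

Let n_neq0 : n%:R != 0 :> R.
Proof. by have [n0 _] := g_irr; rewrite pnatr_eq0 -lt0n. Qed.

(** Write [J = a + J b]. Both [a] and [b] are central in [g], so their squares are scalar; squaring
    [a = J (1 - b)] then makes [b] scalar, and trace zero forces [b = 0]. *)
Lemma mem_complex_structure : J \in gJ -> J \in g.
Proof.
move=> /complex_spanP[a [b [ag bg JE]]].
have central x : x \in g -> mxbr x a = 0 /\ mxbr x b = 0.
  move=> xg; have xJ := sub_complex_span xg.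
  have E : mxbr x a + J *m mxbr x b = 0.
    by rewrite -mxbr_mulJr // -mxbrDr -JE; apply/mxbr_eq0; rewrite Jg.
  have xb0 : mxbr x b = 0.
    apply: (@mulJ_disjoint (- mxbr x a)); rewrite ?memvN ?g_sub //.
    by apply/eqP; rewrite eqr_oppLR -addr_eq0 E.
  by move: E; rewrite xb0 mulmx0 addr0.
have [mu bb] := central_sqr_scalar bg (fun x xg => (central x xg).2).
have [nu aa] := central_sqr_scalar ag (fun x xg => (central x xg).1).
have aE : a = J *m (1%:M - b) by rewrite mulmxBr mulmx1 {1}JE addrK.
have aa' : a *m a = - (1%:M - b *+ 2 + b *m b).
  rewrite aE -[LHS]mulmxA (mulmxA (1%:M - b)).
  have -> : (1%:M - b) *m J = J *m (1%:M - b).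
    by rewrite mulmxBr mulmxBl mulmx1 mul1mx (Jg bg).
  rewrite -[J *m _ *m _]mulmxA (mulmxA J J) JJ mulNmx mul1mx; congr (- _).
  rewrite mulmxBr mulmx1 mulmxBl mul1mx mulr2n; move: (b *m b) => c.
  by apply/matrixP => i j; rewrite !mxE; ring.
have b2 : b *+ 2 = (nu + 1 + mu)%:M.
  move: aa'; rewrite aa bb => H; apply/matrixP => i j.
  by move/matrixP/(_ i j): H; rewrite !mxE; case: (i == j); rewrite ?mulr1n ?mulr0n; lra.
have e0 : nu + 1 + mu = 0.
  have := congr1 mxtrace b2; rewrite raddfMn /= (g_sl bg) mul0rn mxtrace_scalar.
  by move/esym/eqP; rewrite -mulr_natr mulf_eq0 (negPf n_neq0) orbF => /eqP.
have b0 : b = 0.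
  apply/matrixP => i j; move/matrixP/(_ i j): b2; rewrite e0 mulr2n !mxE mul0rn; lra.
by rewrite JE b0 mulmx0 addr0.
Qed.

Hypothesis J_in : J \in g.

(** Polarization: the squares of [c] and of [J + c] are scalar, hence so is the cross term
    [2 J c]. *)
Lemma central_complex_structure c : c \in g ->
  (forall x, x \in g -> mxbr x c = 0) -> exists a : R, c = a *: J.
Proof.
move=> cg cc; have [mu cE] := central_sqr_scalar cg cc.
have [|x xg|nu jcE] := @central_sqr_scalar (J + c); first by rewrite memvD.
  by rewrite mxbrDr cc // addr0; apply/mxbr_eq0; rewrite Jg.
have Jc : J *m c = (2^-1 * (nu + 1 - mu))%:M.
  move: jcE; rewrite mulmxDl !mulmxDr JJ -(Jg cg) cE => H; apply/matrixP => i j.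
  by move/matrixP/(_ i j): H; rewrite !mxE; case: (i == j); rewrite ?mulr1n ?mulr0n; lra.
exists (- (2^-1 * (nu + 1 - mu))).
have -> : c = - (J *m (J *m c)) by rewrite mulmxA JJ mulNmx mul1mx opprK.
by rewrite Jc mul_mx_scalar scaleNr.
Qed.

(** [J [x, y] = [J x, y]] is again a commutator. Together with [trace_derived] this says that the
    complex trace vanishes on [s]. *)
Lemma trace_mulJ_derived x : x \in s -> \tr (J *m x) = 0.
Proof.
move: x; apply: lie_commutator_ind => [|a x y xs ys|x y xg yg].
- by rewrite mulmx0 mxtrace0.
- by rewrite mulmxDr -scalemxAr raddfD /= mxtraceZ xs ys mulr0 addr0.
- have -> : J *m mxbr x y = mxbr (J *m x) y by rewrite mxbr_mulJl.
  by rewrite /mxbr raddfB /= mxtrace_mulC subrr.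
Qed.

Lemma trace_derived x : x \in s -> \tr x = 0.
Proof.
move: x; apply: lie_commutator_ind => [|a x y xs ys|x y xg yg].
- exact: mxtrace0.
- by rewrite raddfD /= mxtraceZ xs ys mulr0 addr0.
- by rewrite /mxbr raddfB /= mxtrace_mulC subrr.
Qed.

(** Subtracting the trace-orthogonal projection to [k] leaves a central element: by invariance its
    bracket with any [z] is orthogonal to itself. Central elements are multiples of [J]. *)
Lemma compact_decomposition y : y \in g ->
  exists x, x \in k /\ exists a : R, y = x + a *: J.
Proof.
move=> yg.
have [||||x xk xE] :=
  @anisotropic_decomposition R _ (fun x y => \tr (x *m y)) g k _ _ _ _ y yg.
- by move=> z a u v; rewrite mulmxDl -scalemxAl raddfD /= mxtraceZ.
- by move=> z a u v; rewrite mulmxDr -scalemxAr raddfD /= mxtraceZ.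
- exact/subvP/compact_derived_sub_g.
- by move=> x xk; exact/(compact_lie_trace_eq0 g_compact)/compact_derived_sub_g.
have yxg : y - x \in g by rewrite memvB // compact_derived_sub_g.
exists x; split=> //.
have [z zg|a yx] := @central_complex_structure (y - x) yxg; last first.
  by exists a; rewrite -yx addrC subrK.
apply: (compact_lie_trace_eq0 g_compact); first exact: g_sub.
rewrite [mxbr z _]mxbrN mulmxN mulNmx opprK mxtrace_mxbr xE //.
apply: mem_lie_commutator => //.
exact: g_sub.
Qed.

Lemma complex_span_decomposition y : y \in gJ ->
  exists x, x \in s /\ exists a b : R, y = x + a *: J + b *: 1%:M.
Proof.
move=> /complex_spanP[p [q [/compact_decomposition[u [uk [a ->]]]
  /compact_decomposition[v [vk [b ->]]] ->]]].
exists (u + J *m v); split.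
  by rewrite memvD // ?derived_mulJ // compact_derived_sub.
exists a, (- b); rewrite mulmxDr -scalemxAr JJ scalerN scaleNr.
by rewrite -!addrA; congr (_ + _); rewrite addrCA.
Qed.

(** [gJ] is spanned by [s], [J] and the identity, and [s] is orthogonal to the last two, so
    nondegeneracy passes from [gJ] to [s]. *)
Lemma derived_trace_nondeg x : x \in s ->
  (forall y, y \in s -> \tr (x *m y) = 0) -> x = 0.
Proof.
move=> xs H; apply: complex_span_trace_nondeg => [|y]; first exact: derived_sub.
move=> /complex_span_decomposition[u [us [a [b ->]]]].
rewrite !mulmxDr -!scalemxAr mulmx1 !raddfD /= !mxtraceZ H //.
by rewrite (trace_derived xs) mxtrace_mulC trace_mulJ_derived // !mulr0 !addr0.
Qed.

(** By invariance of the trace form, an element centralizing [s] is orthogonal to all brackets,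
    which span [s]. *)
Lemma derived_center x : x \in s -> (forall y, y \in s -> mxbr x y = 0) -> x = 0.
Proof.
move=> xs H; apply: derived_trace_nondeg => //.
apply: lie_commutator_ind => [|a u v uP vP|u v /complex_span_decomposition].
- by rewrite mulmx0 mxtrace0.
- by rewrite mulmxDr -scalemxAr raddfD /= mxtraceZ uP vP mulr0 addr0.
- move=> [u' [us [a [b ->]]]] _; rewrite -mxtrace_mxbr !mxbrDr !mxbrZr H //.
  have -> : mxbr x J = 0.
    by apply/mxbr_eq0; rewrite (complex_span_commJ (derived_sub xs)).
  have -> : mxbr x 1%:M = 0 by apply/mxbr_eq0; rewrite mulmx1 mul1mx.
  by rewrite !scaler0 !addr0 mul0mx mxtrace0.
Qed.
End InvariantComplexStructure.

Lemma mulmx_col_eq0 (K : fieldType) (m n : nat) (A : 'M[K]_(m, n)) :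
  (forall v : 'cV[K]_n, A *m v = 0) -> A = 0.
Proof.
move=> A0; apply/matrixP => i j; have := A0 (delta_mx j 0).
by rewrite -colE => /colP/(_ i); rewrite !mxE.
Qed.

(** A commutative subspace of largest dimension is maximal. *)
Lemma exists_maximal_commutative (K : fieldType) (n : nat) (g : {vspace 'M[K]_n}) :
  exists t, maximal_commutative (@mxbr K n) g t.
Proof.
pose Q m := `[< exists2 t : {vspace 'M[K]_n},
  (t <= g)%VS /\ lie_commutative (@mxbr K n) t & \dim t = m >].
have Q0 : exists m, Q m.
  exists (\dim (0%VS : {vspace 'M[K]_n})); apply/asboolP; exists 0%VS => //.
  split; first exact: sub0v.
  by move=> x y; rewrite !memv0 => /eqP -> _; rewrite /mxbr mul0mx mulmx0 subrr.
have Qb m : Q m -> (m <= \dim g)%N by move=> /asboolP[t [tg _] <-]; exact: dimvS.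
case: (ex_maxnP Q0 Qb) => m /asboolP[t [tg tc] tm] mM; exists t; split=> // t' t'g t'c tt'.
apply/esym/eqP; rewrite eqEdim tt' tm mM //.
by apply/asboolP; exists t'.
Qed.

(** * Weights of the complexified adjoint representation *)

Section AdjointWeights.
Variables (R : realType) (n : nat) (g : {vspace 'M[R]_n}) (J : 'M[R]_n).
Hypotheses (g_sub : lie_subalgebra (@mxbr R n) g) (g_sl : in_sl g)
  (g_compact : compact_linear_lie_algebra g) (g_irr : irreducible_linear g)
  (JJ : J *m J = - 1%:M) (Jg : forall x, x \in g -> J *m x = x *m J).
Let k := lie_commutator (@mxbr R n) g.
Let gJ := complex_span J g.
Let s := lie_commutator (@mxbr R n) gJ.

Variable phi : 'Hom('M[R]_n, 'cV[R]_n).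
Hypotheses (phi_ker : (lker phi :&: s = 0)%VS) (phi_im : (phi @: s = fullv)%VS)
  (phi_cscale : forall (z : R[i]) u, u \in s ->
     phi (Defs.cscale J z u) = Defs.cscale J z (phi u))
  (phi_ad : forall x : 'M[R]_n, x \in gJ <->
     exists2 y, y \in s & exists z : R[i],
       forall u, u \in s -> x *m phi u = phi (mxbr y u + Defs.cscale J z u)).
Implicit Types (x y z a b h u w : 'M[R]_n).

Let derived_mulJ' u : u \in s -> J *m u \in s.
Proof. exact: (derived_mulJ JJ Jg). Qed.

Let derived_mxbr x y : x \in s -> y \in s -> mxbr x y \in s.
Proof.
by move=> xs ys; apply: mem_lie_commutator; exact: (derived_sub g_sub JJ Jg).
Qed.

Let derived_commJ x : x \in s -> J *m x = x *m J.
Proof.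
by move=> xs; apply: (complex_span_commJ Jg); exact: (derived_sub g_sub JJ Jg).
Qed.

Let phi_inj u w : u \in s -> w \in s -> phi u = phi w -> u = w.
Proof.
move=> us ws E; apply/eqP; rewrite -subr_eq0 -memv0 -phi_ker memv_cap memv_ker.
by rewrite linearB /= E subrr eqxx memvB.
Qed.

Let phi_surj v : exists2 u, u \in s & v = phi u.
Proof. by apply/memv_imgP; rewrite phi_im memvf. Qed.

Let phiJ u : u \in s -> phi (J *m u) = J *m phi u.
Proof.
move=> us; have := @phi_cscale (0 +i* 1)%C _ us.
by rewrite /Defs.cscale /= !scale0r !add0r !scale1r.
Qed.

Let cscale_derived (z : R[i]) u : u \in s -> Defs.cscale J z u \in s.
Proof. by move=> us; rewrite memvD // memvZ // derived_mulJ'. Qed.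

Let mxbr_cscale x (z : R[i]) u : x \in s ->
  mxbr x (Defs.cscale J z u) = Defs.cscale J z (mxbr x u).
Proof.
move=> xs; rewrite mxbrDr !mxbrZr (mxbr_mulJr Jg) //.
exact: (derived_sub g_sub JJ Jg).
Qed.

Let cscaleD (z : R[i]) u w : Defs.cscale J z (u + w) = Defs.cscale J z u + Defs.cscale J z w.
Proof. by rewrite /Defs.cscale mulmxDr !scalerDr addrACA. Qed.

Let cscaleC (y z : R[i]) u :
  Defs.cscale J y (Defs.cscale J z u) = Defs.cscale J z (Defs.cscale J y u).
Proof.
rewrite /Defs.cscale !mulmxDr -!scalemxAr !(mulmxA J J) !JJ !mulNmx !mul1mx.
by move: (J *m u) => v; apply/matrixP => i j; rewrite !mxE; ring.
Qed.

Lemma mem_J_complex_span : J \in gJ.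
Proof.
apply/phi_ad; exists 0; first exact: mem0v; exists (0 +i* 1)%C => u us.
rewrite /mxbr mul0mx mulmx0 subrr add0r phi_cscale // /Defs.cscale /=.
by rewrite scale0r add0r scale1r.
Qed.

Let J_in : J \in g.
Proof. exact: (mem_complex_structure g_sub g_sl g_compact g_irr JJ Jg mem_J_complex_span). Qed.

(** Transported by [phi], the operator [x] is exactly [ad x'], with no scalar part; [x'] is the
    counterpart of [x] inside [s]. *)
Definition adjoint_action x x' :=
  x' \in s /\ forall u, u \in s -> x *m phi u = phi (mxbr x' u).

(** Elements of [g] act as [ad a'] plus a complex scalar; scalars cancel in brackets, so elements of
    [k] act purely by [ad]. *)
Lemma adjoint_action_exists x : x \in k -> exists x', adjoint_action x x'.
Proof.
move: x; apply: lie_commutator_ind => [|a x y [x' [xs xE]] [y' [ys yE]]|a b].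
- exists 0; split=> [|u us]; first exact: mem0v.
  by rewrite /mxbr !mul0mx mulmx0 subrr raddf0.
- exists (a *: x' + y'); split=> [|u us]; first by rewrite memvD // memvZ.
  by rewrite mulmxDl -scalemxAl xE // yE // mxbrDl mxbrZl linearP.
move=> /(sub_complex_span J) /phi_ad[a' a's [za aE]].
move=> /(sub_complex_span J) /phi_ad[b' b's [zb bE]].
exists (mxbr a' b'); split=> [|u us]; first exact: derived_mxbr.
pose ua := mxbr a' u + Defs.cscale J za u; pose ub := mxbr b' u + Defs.cscale J zb u.
have uas : ua \in s by rewrite memvD // ?cscale_derived // derived_mxbr.
have ubs : ub \in s by rewrite memvD // ?cscale_derived // derived_mxbr.
rewrite [X in X *m _]/mxbr mulmxBl -!mulmxA aE // bE // -/ua -/ub aE // bE // -linearB.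
congr (phi _); rewrite /ua /ub (mxbrDr (mxbr a' u)) (mxbrDr (mxbr b' u)).
rewrite !mxbr_cscale // (cscaleD za (mxbr b' u)) (cscaleD zb (mxbr a' u)) (cscaleC za zb).
rewrite -mxbr_jacobi.
move: (mxbr a' (mxbr b' u)) (mxbr b' (mxbr a' u)) => p q.
move: (Defs.cscale J zb (mxbr a' u)) (Defs.cscale J za (mxbr b' u)) => p1 q1.
move: (Defs.cscale J zb (Defs.cscale J za u)) => r1.
by apply/matrixP => i j; rewrite !mxE; ring.
Qed.

(** [ad [x', y']] is the commutator of the two actions, hence zero, and [s] has trivial center. *)
Lemma adjoint_action_inj x x' y y' : adjoint_action x x' -> adjoint_action y y' ->
  mxbr x y = 0 -> mxbr x' y' = 0.
Proof.
move=> [xs xE] [ys yE] /mxbr_eq0 xy.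
apply: (derived_center g_sub g_compact g_irr JJ Jg J_in).
  exact: derived_mxbr.
move=> u us; apply: phi_inj; rewrite ?mem0v //; first by do 2 apply: derived_mxbr => //.
rewrite -mxbr_jacobi linearB /= raddf0.
rewrite -xE ?derived_mxbr // -yE // -yE ?derived_mxbr // -xE // !mulmxA xy.
by rewrite subrr.
Qed.

Lemma adjoint_action_commute x x' y y' : adjoint_action x x' -> adjoint_action y y' ->
  mxbr x' y' = 0 -> mxbr x y = 0.
Proof.
move=> [xs xE] [ys yE] xy.
apply: mulmx_col_eq0 => v; have [u us ->] := phi_surj v.
rewrite [X in X *m _]/mxbr mulmxBl -!mulmxA xE // yE //.
rewrite xE ?derived_mxbr // yE ?derived_mxbr //.
by rewrite -linearB mxbr_jacobi xy /mxbr mul0mx mulmx0 subrr raddf0.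
Qed.

Variable t : {vspace 'M[R]_n}.
Hypothesis t_max : maximal_commutative (@mxbr R n) k t.

Let t_in h : h \in t -> h \in g.
Proof.
by have [/subvP tk _ _] := t_max => /tk; exact: (compact_derived_sub_g g_sub).
Qed.

(** The operators [J h], for [h] in [t], commute and are diagonalizable over R. The [f j] are common
    eigenvectors, and [be j h] is the eigenvalue of [- J h] on [f j]. *)
Lemma exists_weights : exists (f : 'I_n -> 'cV[R]_n) (be : 'I_n -> 'M[R]_n -> R),
  [/\ forall j, linear (be j : 'M[R]_n -> R^o),
      forall j h, h \in t -> h *m f j = be j h *: (J *m f j),
      forall v, exists c : 'I_n -> R, v = \sum_j c j *: f j
    & forall c : 'I_n -> R, \sum_j c j *: f j = 0 -> forall j, c j = 0].
Proof.
have [_ tc _] := t_max.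
have [|A /mapP[h /vbasis_mem /t_in hg ->]|P Pu Pd] :=
  @simultaneous_diagonalization _ _ [seq J *m h | h <- vbasis t].
- move=> _ _ /mapP[x /vbasis_mem xt ->] /mapP[y /vbasis_mem yt ->].
  have /mxbr_eq0 xy := tc _ _ xt yt.
  by rewrite -!mulmxA !(mulmxA _ J) -!Jg ?t_in // -!mulmxA xy.
- apply: bounded_mexp_complex_structure; last exact: Jg.
    exact: (compact_lie_bounded_mexp g_compact).
  exact: (compact_lie_bounded_mexp g_compact).
have Pdiag h : h \in t -> exists d : 'rV[R]_n, P *m (J *m h) = diag_mx d *m P.
  move=> ht; rewrite (coord_vbasis ht).
  apply: (big_ind (fun h => exists d : 'rV[R]_n, P *m (J *m h) = diag_mx d *m P)).
  - by exists 0; rewrite !mulmx0 raddf0 mul0mx.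
  - by move=> x y [d dE] [e eE]; exists (d + e); rewrite !mulmxDr raddfD mulmxDl dE eE.
  - move=> i _; have [|d dE] := Pd (J *m (vbasis t)`_i).
      by apply: map_f; rewrite mem_nth // size_tuple.
    exists (coord (vbasis t) i h *: d).
    by rewrite -!scalemxAr dE [diag_mx (_ *: d)]linearZ /= scalemxAl.
(* A diagonal entry is linear in every matrix [h]; it is an eigenvalue for [h] in [t]. *)
pose be j h := - (P *m (J *m h) *m invmx P) j j.
have fE (c : 'I_n -> R) : \sum_j c j *: col j (invmx P) = invmx P *m (\col_j c j).
  apply/colP => i; rewrite summxE mxE; apply: eq_bigr => j _.
  by rewrite !mxE mulrC.
exists (fun j => col j (invmx P)), be; split.
- move=> j a x y; rewrite /be !mulmxDr mulmxDl -!scalemxAr -scalemxAl !mxE.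
  by rewrite opprD -mulrN.
- move=> j h ht; have [d dE] := Pdiag h ht.
  have JhP : J *m h *m invmx P = invmx P *m diag_mx d.
    by apply: (can_inj (mulKmx Pu)); rewrite mulmxA dE mulmxK // mulKVmx.
  have -> : be j h = - d 0 j by rewrite /be dE mulmxK // !mxE eqxx mulr1n.
  have -> : h *m col j (invmx P) = - (J *m (J *m h *m col j (invmx P))).
    by rewrite -!mulmxA mulmxA JJ mulNmx mul1mx opprK.
  rewrite scaleNr; congr (- _).
  have -> : J *m h *m col j (invmx P) = d 0 j *: col j (invmx P).
    rewrite colE mulmxA JhP -mulmxA -[diag_mx d *m _]colE scalemxAr.
    congr (_ *m _); apply/colP => i; rewrite !mxE eqxx andbT.
    by case: eqP => [->|_]; rewrite ?mulr1 ?mulr0 ?mulr1n ?mulr0n.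
  by rewrite scalemxAr.
- move=> v; exists (fun j => (P *m v) j 0); rewrite fE.
  have -> : \col_j (P *m v) j 0 = P *m v by apply/colP => j; rewrite mxE.
  by rewrite mulKmx.
- move=> c; rewrite fE => /(congr1 (mulmx P)); rewrite mulKVmx // mulmx0.
  by move=> /colP E j; have := E j; rewrite !mxE.
Qed.

Variables (f : 'I_n -> 'cV[R]_n) (be : 'I_n -> 'M[R]_n -> R).
Hypotheses (be_lin : forall j, linear (be j : 'M[R]_n -> R^o))
  (fE : forall j h, h \in t -> h *m f j = be j h *: (J *m f j))
  (f_span : forall v, exists c : 'I_n -> R, v = \sum_j c j *: f j)
  (f_free : forall c : 'I_n -> R, \sum_j c j *: f j = 0 -> forall j, c j = 0).

Let t_in_k h : h \in t -> h \in k.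
Proof. by have [/subvP tk _ _] := t_max => /tk. Qed.

Let mulJ_eq0 p (u : 'M[R]_(n, p)) : J *m u = 0 -> u = 0.
Proof.
move=> Ju; have : J *m (J *m u) = 0 by rewrite Ju mulmx0.
by rewrite mulmxA JJ mulNmx mul1mx => /eqP; rewrite oppr_eq0 => /eqP.
Qed.

(* Weight vectors of weights [a], [b] with [a + b <> 0] are orthogonal for the
   trace form, which is nondegenerate on [s]. *)
Lemma weights_symmetric j : exists i, forall h, h \in t -> be i h = - be j h.
Proof.
apply: contrapT => nsym.
have /choice[U UP] (i : 'I_n) : exists u, u \in s /\ f i = phi u.
  by have [u us ->] := phi_surj (f i); exists u.
have adU h h' i : h \in t -> adjoint_action h h' -> mxbr h' (U i) = be i h *: (J *m U i).
  move=> ht [hs hE]; have [Us Uf] := UP i.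
  apply: phi_inj; first exact: derived_mxbr; first by rewrite memvZ // derived_mulJ'.
  by rewrite -hE // -Uf fE // linearZ /= phiJ // -Uf.
have orth i : \tr (J *m U j *m U i) = 0.
  have [h [ht hne]] : exists h, h \in t /\ be i h != - be j h.
    apply: contrapT => H; apply: nsym; exists i => h ht; apply/eqP.
    by apply: contrapT => hne; apply: H; exists h; split=> //; apply/negP.
  have [h' hh'] := adjoint_action_exists (t_in_k ht).
  have [Ujs _] := UP j; have [Uis _] := UP i.
  have := mxtrace_mxbr (U j) h' (U i).
  rewrite [mxbr (U j) h']mxbrN !(adU h) // mulNmx raddfN /= -scalemxAl -scalemxAr.
  rewrite !mxtraceZ mulmxA -derived_commJ // => /eqP.
  rewrite -subr_eq0 -mulNr -mulrBl mulf_eq0 => /orP[|/eqP //].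
  by rewrite subr_eq0 eq_sym (negPf hne).
have [Ujs Ujf] := UP j.
(* The [U i] span [s], so [J U_j] is orthogonal to all of [s]. *)
have JUj : J *m U j = 0.
  apply: (derived_trace_nondeg g_sub g_compact g_irr JJ Jg J_in).
    exact: derived_mulJ'.
  move=> w ws; have [c cE] := f_span (phi w).
  have -> : w = \sum_i c i *: U i.
    apply: phi_inj => //; first by apply: memv_suml => i _; rewrite memvZ //; have [] := UP i.
    rewrite cE linear_sum; apply: eq_bigr => i _; have [_ ->] := UP i.
    by rewrite linearZ.
  rewrite mulmx_sumr raddf_sum big1 // => i _ /=.
  by rewrite -scalemxAr mxtraceZ orth mulr0.
have fj0 : f j = 0 by rewrite Ujf (mulJ_eq0 JUj) raddf0.
have fj : \sum_i (i == j)%:R *: f i = 0.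
  rewrite (bigD1 j) //= fj0 scaler0 add0r big1 // => i /negPf ->.
  by rewrite scale0r.
by have /eqP := f_free fj j; rewrite eqxx oner_eq0.
Qed.

Lemma weights_separate d : d \in t -> (forall j, be j d = 0) -> d = 0.
Proof.
move=> dt d0; apply: mulmx_col_eq0 => v; have [c ->] := f_span v.
rewrite mulmx_sumr big1 // => j _.
by rewrite -scalemxAr fE // d0 scale0r scaler0.
Qed.

Let weight_sum h (c : 'I_n -> R) : h \in t ->
  h *m (\sum_j c j *: f j) = J *m (\sum_j (c j * be j h) *: f j).
Proof.
move=> ht; rewrite !mulmx_sumr; apply: eq_bigr => j _.
by rewrite -!scalemxAr fE // scalerA.
Qed.

Lemma exists_rank_one_stabilizer :
  exists v : 'cV[R]_n, has_rank (@mxbr R n) (stabilizer g v) 1.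
Proof.
have [h ht [hreg hspan]] :=
  exists_spanning_regular be_lin weights_symmetric weights_separate.
(* On a weight vector with [be j h = 1], [h] acts as [J], so [h - J] kills the sum [v] of these
   vectors. *)
pose x := h - J; pose v := \sum_j (be j h == 1)%:R *: f j; exists v.
have stabP y : (y \in stabilizer g v) = (y \in g) && (y *m v == 0).
  by rewrite /stabilizer memv_cap memv_ker lfunE.
have xg : x \in g by rewrite memvB // t_in.
have xv : x *m v = 0.
  rewrite mulmxBl weight_sum // -mulmxBr -sumrB big1 ?mulmx0 // => j _.
  by rewrite -scalerBl; case: eqP => [->|_]; rewrite ?mulr1 ?mul0r subrr scale0r.
(* The trace of [J h] vanishes for [h] in [k], whereas that of [J J] is [- n]. *)
have x0 : x != 0.
  rewrite subr_eq0; apply/eqP => hJ.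
  have := trace_mulJ_derived Jg (compact_derived_sub J (t_in_k ht)).
  rewrite hJ JJ raddfN /= mxtrace1 => /eqP; rewrite oppr_eq0 pnatr_eq0.
  by have [n0 _] := g_irr; rewrite -leqn0 leqNgt n0.
have centr y : y \in g -> y *m v = 0 -> mxbr x y = 0 -> y \in <[x]>%VS.
  move=> yg yv xy.
  have [yk [ykk [c yE]]] := compact_decomposition g_sub g_compact g_irr JJ Jg J_in yg.
  have ykg : yk \in g by apply: (compact_derived_sub_g g_sub).
  have hyk : mxbr h yk = 0.
    move: xy; rewrite /x yE -scaleN1r mxbrDl !mxbrDr !mxbrZl !mxbrZr.
    have -> : mxbr J yk = 0 by apply/mxbr_eq0; exact: Jg.
    have -> : mxbr h J = 0 by apply/mxbr_eq0; rewrite Jg // t_in.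
    by rewrite mxbrxx !scaler0 !addr0.
  have [h' hh'] := adjoint_action_exists (t_in_k ht).
  have [y' yy'] := adjoint_action_exists ykk; have [y's _] := yy'.
  have [h's h'E] := hh'.
  have h'y' := adjoint_action_inj hh' yy' hyk.
  (* Since [y'] commutes with [h'], [phi y'] involves only weights vanishing at [h]. By regularity
     these vanish on [t], so [yk] centralizes [t] and lies in it. *)
  have [a aE] := f_span (phi y').
  have ah j : a j * be j h = 0.
    apply: (f_free (c := fun j => a j * be j h)); apply: mulJ_eq0.
    by rewrite -weight_sum // -aE h'E // h'y' raddf0.
  have ykt : yk \in t.
    apply: (maximal_commutative_centralizer t_max) => // h2 h2t.
    have [h2' hh2] := adjoint_action_exists (t_in_k h2t); have [h2s h2E] := hh2.
    apply: (adjoint_action_commute hh2 yy'); apply: phi_inj; rewrite ?mem0v ?derived_mxbr //.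
    rewrite -h2E // aE weight_sum // raddf0 big1 ?mulmx0 // => j _.
    have [b0|bh] := hreg j; first by rewrite b0 // mulr0 scale0r.
    have /eqP := ah j; rewrite mulf_eq0 (negPf bh) orbF => /eqP ->.
    by rewrite mul0r scale0r.
  (* On [f j], the element [y = yk + c J] acts as [(be j yk + c) J], and [y v = 0]. The weights
     equal to 1 at [h] then force [yk = - c h], that is, [y = - c x]. *)
  have act j : be j h = 1 -> be j yk = - c.
    move=> bj; have : \sum_j ((be j h == 1)%:R * be j yk + c * (be j h == 1)%:R) *: f j = 0.
      apply: mulJ_eq0; rewrite -[RHS]yv yE mulmxDl -scalemxAl (weight_sum _ ykt).
      rewrite scalemxAr -mulmxDr; congr (_ *m _); rewrite scaler_sumr -big_split /=.
      by apply: eq_bigr => i _; rewrite scalerA scalerDl.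
    move=> /f_free/(_ j); rewrite bj eqxx mul1r mulr1 => /eqP.
    by rewrite addr_eq0 => /eqP.
  have ych : yk + c *: h = 0.
    apply: hspan => [|j bj]; first by rewrite memvD // memvZ.
    by rewrite addrC be_lin bj (act j bj) /GRing.scale /= mulr1 subrr.
  apply/vlineP; exists (- c); rewrite yE /x scalerBr !scaleNr opprK.
  by congr (_ + _); apply/eqP; rewrite -addr_eq0 ych.
exists <[x]>%VS; last by rewrite dim_vline x0.
split=> [|y z|t' t'g t'c xt'].
- by rewrite -memvE stabP xg xv eqxx.
- by move=> /vlineP[a ->] /vlineP[b ->]; rewrite mxbrZl mxbrZr mxbrxx !scaler0.
- apply/eqP; rewrite eqEsubv xt' andbT; apply/subvP => y yt'.
  have := subvP t'g _ yt'; rewrite stabP => /andP[yg /eqP yv].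
  by apply: centr => //; apply: t'c => //; apply: (subvP xt'); rewrite memv_line.
Qed.
End AdjointWeights.

Unset Implicit Arguments.

Theorem mainTheorem2 (R : realType) (n : nat) (g : {vspace 'M[R]_n}) (r : nat)
  (g_sub : lie_subalgebra (@mxbr R n) g)
  (g_sl : in_sl g)
  (g_compact : compact_linear_lie_algebra g)
  (g_irr : irreducible_linear g)
  (g_rank : has_rank (@mxbr R n) g r)
  (r_gt1 : (1 < r)%N)
  (g_simple : lie_simple (@mxbr R n) (lie_commutator (@mxbr R n) g)) :
  (adjoint_simple g ->
     ~ exists v : 'cV[R]_n, has_rank (@mxbr R n) (stabilizer g v) 1)
  /\
  (reducible_linear (complexify g) ->
   (exists2 J : 'M[R]_n,
      invariant_complex_structure g J & adjoint_plus_scalars J g) ->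
     exists v : 'cV[R]_n, has_rank (@mxbr R n) (stabilizer g v) 1).
Proof.
split=> [g_ad [v]|_ [J [JJ Jg] [phi [phi_ker phi_im phi_cscale phi_ad]]]].
  have [t tmax dt] := g_rank; rewrite -dt in r_gt1.
  exact: (adjoint_stabilizer_rank_neq1 g_sub g_compact tmax).
(* The weights are taken on a maximal commutative subalgebra of the commutator; the central
   direction [J] returns in the element [h - J]. *)
have [t tmax] := exists_maximal_commutative (lie_commutator (@mxbr R n) g).
have [f [be [be_lin fE f_span f_free]]] := exists_weights g_sub g_sl g_compact
  g_irr JJ Jg phi_cscale phi_ad tmax.
exact: (exists_rank_one_stabilizer g_sub g_sl g_compact g_irr JJ Jg phi_ker
  phi_im phi_cscale phi_ad tmax be_lin fE f_span f_free).
Qed.
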